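(* Let $k,n\ge1$ and $\tau_1,\ldots,\tau_n\in[0,r]$. The joint cumulant $c^{(\lambda)}_{k+1,n}(\tau_1;\ldots;\tau_n)$ of $\sigma_{k+1}((k+1)r-\tau_1),\ldots,\sigma_{k+1}((k+1)r-\tau_n)$ satisfies the recursion $$c^{(\lambda)}_{k+1,n}(\tau_1;\ldots;\tau_n)=\sum_{l=1}^n\ \sum_{\pi_1\cup\cdots\cup\pi_l=\{1,\ldots,n\}}\int_0^{\widehat\tau_{\pi_1}}\cdots\int_0^{\widehat\tau_{\pi_l}}c^{(\lambda)}_{k,l}(\bar s_{\pi_1};\ldots;\bar s_{\pi_l})\,\lambda_k(ds_1)\cdots\lambda_k(ds_l),$$ where the inner sum runs over the partitions $\{\pi_1,\ldots,\pi_l\}$ of $\{1,\ldots,n\}$ into $l$ blocks, and $\widehat\tau_\pi:=\min_{i\in\pi}\tau_i$ for $\pi\subset\{1,\ldots,n\}$.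
   Context: Let $r>0$ be the connection radius of the one-dimensional unit disk random graph. For each $k\ge1$, nodes are distributed on $[0,kr]$ according to a Poisson point process with intensity $\lambda(ds)=\sum_{l=1}^k\mathbf 1_{((l-1)r,lr]}(s)\,\lambda_l((l-1)r+ds)$, where $\lambda_l(ds)=\lambda_l(s)ds$ are absolutely continuous intensity measures on $[0,r]$; that is, the intensity on the cell $((l-1)r,lr]$ is $\lambda_l$ with coordinate measured from the left endpoint $(l-1)r$. Additional nodes are located at $0$ and at $t\in[0,kr]$. Two nodes $s,t$ are connected if and only if $|t-s|\le r$. $\sigma_k(t)$ denotes the count of $k$-hops between the nodes at $0$ and $t$, a $k$-hop being a path made of $k$ edges that links $0$ to $t$ through $k-1$ nodes of the Poisson process; in the one-hop case $\sigma_1(t)=1$ for $t\in[0,r]$. The counts for different endpoints $t$ are computed from the same Poisson process. The joint cumulant of random variables $X_1,\ldots,X_n$ is $\kappa(X_1,\ldots,X_n)=\sum_{l=1}^n(l-1)!(-1)^{l-1}\sum_{\pi_1\cup\cdots\cup\pi_l=\{1,\ldots,n\}}\prod_{j=1}^l\mathbb E\big[\prod_{i\in\pi_j}X_i\big]$, the inner sum being over partitions of $\{1,\ldots,n\}$ into $l$ blocks. $c^{(\lambda)}_{k,n}(\tau_1;\ldots;\tau_n)$ denotes the joint cumulant $\kappa(\sigma_k(kr-\tau_1),\ldots,\sigma_k(kr-\tau_n))$. Given a partition $\{\pi_1,\ldots,\pi_l\}$ of $\{1,\ldots,n\}$ and $s_1,\ldots,s_l\in[0,r]$, $c^{(\lambda)}_{k,l}(\bar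 s_{\pi_1};\ldots;\bar s_{\pi_l})$ denotes the joint cumulant $\kappa\big((\sigma_k(kr-s_1))^{|\pi_1|},\ldots,(\sigma_k(kr-s_l))^{|\pi_l|}\big)$.
   Formalization: The measure λ_k(ds_i) in the recursion is read as λ_k(r−s_i)ds_i, since the node at kr−s_i has left coordinate r−s_i; with λ_k(s_i)ds_i the claim fails (k=n=1, λ_1 the indicator of [0,r/2], τ=r/2 gives 0 versus r/2). *)

(* Defs.v *)
From HB Require Import structures.
From mathcomp Require Export all_boot all_order all_algebra.
From mathcomp Require Export finmap.
From mathcomp Require Export all_classical all_reals all_analysis.
Export Order.TTheory GRing.Theory Num.Theory.
Export numFieldNormedType.Exports.

Set Implicit Arguments.
Unset Strict Implicit.
Unset Printing Implicit Defensive.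

Local Open Scope classical_set_scope.
Local Open Scope ring_scope.

Section point_process.
Context (R : realType) (d : measure_display) (Omega : measurableType d).
Variable P : probability Omega R.

(* The intensities considered below are finite and diffuse, so a realization
   of the process is a finite set of points (no multiplicities). *)
Definition node_count (eta : Omega -> {fset R}) (A : set R) (w : Omega) : nat :=
  #|` [fset x in eta w | x \in A]%fset|.

(* The Poisson mass is spelled out because [poisson_pmf 0] is constantly 1;
   here mean 0 gives the Dirac mass at 0 since [0 ^+ 0 = 1]. *)
Definition poisson_process (D : set R) (Lambda : set R -> \bar R)
    (eta : Omega -> {fset R}) : Prop :=
  [/\ (forall w x, x \in eta w -> D x),
      (forall A : set (measurableTypeR R), measurable A ->
         measurable_fun setT (node_count eta A)),
      (forall (A : set (measurableTypeR R)) (c : nat), measurable A ->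
         let mean := fine (Lambda A) in
         P [set w | node_count eta A w = c] =
         (mean ^+ c / c`!%:R * expR (- mean))%:E) &
      (forall m (A : 'I_m -> set (measurableTypeR R)) (c : 'I_m -> nat),
         (forall i, measurable (A i)) ->
         (forall i j, i != j -> A i `&` A j = set0) ->
         P [set w | forall i, node_count eta (A i) w = c i] =
         (\prod_(i < m) P [set w | node_count eta (A i) w = c i])%E)].

Definition joint_cumulant (n : nat) (X : 'I_n -> Omega -> R) : R :=
  \sum_(1 <= l < n.+1) (l.-1)`!%:R * (-1) ^+ l.-1 *
    \sum_(pi : {set {set 'I_n}} |
            finset.partition pi [set: 'I_n]%SET && (#|pi| == l))
      \prod_(B in pi) fine ('E_P[(fun w => \prod_(i in B) X i w)%R])%E.

End point_process.

Section unit_disk_graph.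
Context (R : realType).
Variable r : R.

Definition linked : rel R := fun s t => `|t - s| <= r.

(* Intermediate nodes are listed in order from 0 to t and are distinct. *)
Definition hop_count (V : {fset R}) (k : nat) (t : R) : nat :=
  #|[set p : k.-1.-tuple V | uniq p &&
       path linked 0 (rcons [seq val x | x <- p] t)]%SET|.

Definition cell_density (f : R -> R) : Prop :=
  (forall s, 0 <= s <= r -> 0 <= f s) /\
  (@lebesgue_measure R).-integrable `[0, r] (EFin \o f).

(* [lam l] (l >= 1) is the density of the intensity on the l-th cell
   ](l-1)r, lr], in the coordinate measured from the left endpoint. *)
Definition intensity_density (lam : nat -> R -> R) (k : nat) (x : R) : R :=
  \sum_(1 <= l < k.+1)
    \1_(`](l.-1%:R * r), (l%:R * r)]) x * lam l (x - l.-1%:R * r).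

Definition intensity (lam : nat -> R -> R) (k : nat) (A : set R) : \bar R :=
  (\int[@lebesgue_measure R]_(x in A) (intensity_density lam k x)%:E)%E.

(* The minimum of [tau] over [B], for nonempty [B] and [tau] bounded by r;
   the seed r is then irrelevant. *)
Definition block_min (n : nat) (tau : 'I_n -> R) (B : {set 'I_n}) : R :=
  \big[Num.min/r]_(i in B) tau i.

End unit_disk_graph.

(* For u = [:: u_1; ...; u_l], the integral of f [:: s_1; ...; s_l] against
   g(s_1)ds_1 ... g(s_l)ds_l over [0, u_1] x ... x [0, u_l]. *)
Fixpoint iterated_integral (R : realType) (g : R -> R) (u : seq R)
    (f : seq R -> R) : R :=
  if u is u1 :: u' then
    \int[@lebesgue_measure R]_(s in `[0, u1])
      (iterated_integral g u' (fun ss => f (s :: ss)) * g s)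
  else f [::].

(* Main.v *)
(* A path of k+1 hops from 0 to (k+1)r - tau, tau <= r, passes through exactly
   one node of each of the first k cells. Hence sigma_{k+1}((k+1)r - tau) is the
   sum of sigma_k(y) over the nodes y >= kr - tau of the k-th cell, while
   sigma_k(y) only depends on the nodes of the previous cells, which are
   independent of the k-th one. Given the previous cells, Mecke's formula turns
   the mixed moments of these sums into sums over set partitions pi of products
   over the blocks B of
     Z_B = int_0^{min_B tau} sigma_k(kr - s)^#|B| lambda_k(ds).
   As cumulants are inverted from moments by the partition lattice, the joint
   cumulant of the sums is the sum over pi of the joint cumulants of
   (Z_B)_{B in pi}; and since joint cumulants are multilinear, the integrals in
   the Z_B can be pulled out one at a time by Tonelli's theorem. *)

From HB Require Import structures.
Require Import Defs.
From mathcomp Require Import measurable_realfun ring lra zify.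

Set Implicit Arguments.
Unset Strict Implicit.
Unset Printing Implicit Defensive.

Local Open Scope ring_scope.
Local Notation setpart := finset.partition.

(** * Sums over set partitions and joint cumulants *)

(** No relation is assumed between [eta k] and [eta k.+1], so the two sides of the recursion involve
    processes whose joint law is unknown. Independence of the cells is therefore replaced by an
    identity of laws: [eta k.+1] is distributed as the configuration [glue] on [Omega * Omega], made
    of the nodes of [eta k] in the first k-1 cells and of those of an independent copy of [eta k.+1]
    beyond them. Tonelli's theorem on the product space then plays the role of conditioning. Hop
    counts ask for distinct nodes, which spoils the recursion on the last node. They are replaced by
    [walks]; for the endpoints considered the two agree unless a node falls on a multiple of [r], a
    null event. Mecke's formula is proved for functions of finitely many cell counts, where it is an
    identity between Poisson weights; bounded integer-valued functions reduce to this case through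
    their level sets. Finiteness everywhere comes from polynomial bounds in the number of nodes,
    whose own moments are given by the same moment formula. *)

Section partition_sums.
Import mathcomp.boot.fintype mathcomp.boot.finset.
Variables (R : comNzRingType) (T : finType).
Implicit Types (C D B : {set T}) (pi rho : {set {set T}}).

(** Partitions are sorted by the block [S] of [x]; what remains is an arbitrary partition of
    [C :\: S]. The induction for the Poisson moments produces the same recursion. *)
Lemma sum_partition_pblock (phi : {set T} -> R) C x : x \in C ->
  \sum_(pi | setpart pi C) \prod_(B in pi) phi B =
  \sum_(S : {set T} | (x \in S) && (S \subset C))
     phi S * \sum_(pi | setpart pi (C :\: S)) \prod_(B in pi) phi B.
Proof.
move=> xC; rewrite (partition_big (fun pi : {set {set T}} => pblock pi x)
  (fun S : {set T} => (x \in S) && (S \subset C))) /=; last first.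
  move=> pi piP; have xpi : x \in cover pi by rewrite (cover_partition piP).
  by rewrite mem_pblock xpi (partitionS piP) // pblock_mem.
apply: eq_bigr => S /andP[xS SC]; rewrite mulr_sumr.
rewrite (reindex_onto (fun pi => S |: pi) (fun pi => pi :\ S)) /=; last first.
  move=> pi /andP[piP /eqP <-]; rewrite setD1K //.
  by rewrite pblock_mem // (cover_partition piP).
have S0 : S != set0 by apply/set0Pn; exists x.
have nS pi : setpart pi (C :\: S) -> S \notin pi.
  move=> piP; apply/negP => Spi; have /subsetP/(_ _ xS) := partitionS piP Spi.
  by rewrite inE xS.
apply: eq_big => [pi|pi /andP[/andP[piP _] /eqP e]].
  apply/idP/idP => [/andP[/andP[piP _] /eqP e]|piP].
    by rewrite -e; apply: partitionD1 => //; rewrite setU11.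
  have piP' : setpart (S |: pi) C.
    have -> : C = S :|: (C :\: S) by rewrite setDE setUIr setUCr setIT (setUidPr SC).
    apply: partitionU1 => //; rewrite disjoint_sym; apply/pred0P => y /=.
    by rewrite !inE; case: (y \in S); rewrite ?andbF.
  rewrite piP' setU1K ?eqxx ?andbT ?nS //.
  by apply/eqP; apply: def_pblock; rewrite ?(partition_trivIset piP') ?setU11.
rewrite big_setU1 //=; apply/negP => Spi.
by move: (setU11 S pi); rewrite -e in Spi; rewrite !inE eqxx in Spi.
Qed.

(** A member of [pi] inside [cover Q] meets some member of [Q], hence equals it by disjointness.
    Merging the blocks of [Q] thus loses no information, which makes coarsening invertible. *)
Lemma partition_sub_cover (C : {set T}) (pi : {set {set T}})
    (rho : {set {set {set T}}}) Q :
  setpart pi C -> setpart rho pi -> Q \in rho ->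
  [set B in pi | B \subset cover Q] = Q.
Proof.
move=> piP rhoP Qrho; apply/setP => B; rewrite inE.
have sQ := subsetP (partitionS rhoP Qrho).
apply/andP/idP => [[Bpi BQ]|BQ]; last first.
  by split; [exact: sQ | exact: (bigcup_max B)].
have /set0Pn[x xB] := partition_neq0 piP Bpi.
have /bigcupP[B' B'Q xB'] := subsetP BQ _ xB.
have tI := partition_trivIset piP.
by rewrite -(def_pblock tI Bpi xB) (def_pblock tI (sQ _ B'Q) xB').
Qed.

(* A partition of a partition [pi] of [C] amounts to a coarser partition of [C]
   together with a partition of each of its blocks. *)
Lemma sum_partition_coarsen (mu : nat -> R) (M : {set {set T}} -> R) C :
  \sum_(rho | setpart rho C)
     mu #|rho| * \prod_(D in rho) \sum_(pi | setpart pi D) M pi =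
  \sum_(pi | setpart pi C) \sum_(rho : {set {set {set T}}} | setpart rho pi)
     mu #|rho| * \prod_(Q in rho) M Q.
Proof.
(* On the right [pi] is determined by [rho] as its cover, so only a sum over [rho] is left. *)
rewrite (exchange_big_dep (fun rho : {set {set {set T}}} =>
   setpart (cover rho) C && setpart rho (cover rho))) /=; last first.
  by move=> pi rho piP rhoP; rewrite (cover_partition rhoP) piP.
under [RHS]eq_bigr => rho /andP[cP rP].
  rewrite (big_pred1 (cover rho)); last first.
    by move=> pi /=; apply/andP/eqP => [[_ /cover_partition->]|->].
  over.
rewrite (partition_big (fun rho : {set {set {set T}}} => cover @: rho)
   (fun rho => setpart rho C)) /=; last first.
  by move=> rho /andP[cP rP]; have [] := partition_partition cP rP.
apply: eq_bigr => rho rhoP.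
rewrite (big_distr_big_dep set0) /=.
(* On the left, the distributive law chooses a function [f] sending each block [D] to a partition of
   [D]. [h'] forgets the labels [D], [h] recovers them; [set0] off [rho] is the default value that
   [pfamily] requires. *)
pose h (r' : {set {set {set T}}}) : {ffun {set T} -> {set {set T}}} :=
  [ffun D => if D \in rho then [set B in cover r' | B \subset D] else set0].
pose h' (f : {ffun {set T} -> {set {set T}}}) : {set {set {set T}}} :=
  [set f D | D in rho].
pose Pf := pfamily set0 (mem rho) (fun D (pi : {set {set T}}) => setpart pi D).
have fP f : f \in Pf -> [/\ setpart (h' f) (cover (h' f)),
    setpart (cover (h' f)) C, [set cover Q | Q in h' f] = rho,
    {in rho &, injective f} & h (h' f) = f].
  move=> /pfamilyP[fsupp fD].
  have pf D : D \in rho -> setpart (f D) D by move=> /fD.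
  have cf D : D \in rho -> cover (f D) = D by move=> /pf/cover_partition.
  have disB D D' B B' : D \in rho -> D' \in rho -> D != D' -> B \in f D ->
      B' \in f D' -> [disjoint B & B'].
    move=> Dr D'r DD' BD BD'.
    have /trivIsetP/(_ _ _ Dr D'r DD') := partition_trivIset rhoP.
    by apply: disjointW; [exact: partitionS (pf _ Dr) BD
      | exact: partitionS (pf _ D'r) BD'].
  have [||rP finj] := @indexed_partition _ _ (mem rho) f.
  - move=> D D' Dr D'r DD'; rewrite -setI_eq0; apply/negPn/negP => /set0Pn[B].
    rewrite inE => /andP[BD BD']; have B0 := partition_neq0 (pf _ Dr) BD.
    rewrite eq_sym in DD'.
    by move: (disB _ _ _ _ Dr D'r DD' BD BD'); rewrite -setI_eq0 setIid (negPf B0).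
  - move=> D Dr; apply/eqP => f0; move: (cf _ Dr) (partition_neq0 rhoP Dr).
    by rewrite f0 /cover big_set0 => <-; rewrite eqxx.
  rewrite -/(h' f) in rP.
  have cP : setpart (cover (h' f)) C.
    apply/and3P; split.
    - rewrite /h' cover_imset; apply/eqP/setP => x; apply/bigcupP/idP.
        move=> [B /bigcupP[D Dr BD] xB]; apply: (subsetP (partitionS rhoP Dr)).
        exact: (subsetP (partitionS (pf _ Dr) BD)).
      rewrite -(cover_partition rhoP) => /bigcupP[D Dr].
      rewrite -{1}(cf _ Dr) => /bigcupP[B BD xB]; exists B => //.
      by apply/bigcupP; exists D.
    - apply/trivIsetP => B B'; rewrite /h' cover_imset.
      move=> /bigcupP[D Dr BD] /bigcupP[D' D'r BD'] BB'.
      have [eD|DD'] := eqVneq D D'; last exact: disB Dr D'r DD' BD BD'.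
      rewrite -eD in BD'.
      by have /trivIsetP := partition_trivIset (pf _ Dr); apply.
    - rewrite /h' cover_imset; apply/bigcupP => -[D Dr].
      by apply/negP; rewrite (partition0 (pf _ Dr)).
  split => //.
  - rewrite /h' -imset_comp -[RHS]imset_id; apply: eq_in_imset => D Dr /=.
    exact: cf.
  - apply/ffunP => D; rewrite ffunE; case: ifPn => Dr.
      rewrite -{1}(cf _ Dr). apply: (partition_sub_cover cP rP).
      exact: imset_f.
    by apply/esym/eqP; apply: contraNT Dr => fD0; apply: (subsetP fsupp).
rewrite (reindex_onto h h') /=; last by move=> f /fP[].
rewrite mulr_sumr; apply: eq_big => [r'|r'].
  apply/andP/andP => [[hr' /eqP hK]|[/andP[cP rP] /eqP e]].
    have [rP cP e _ _] := fP _ hr'; rewrite !hK in rP cP e.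
    by rewrite cP rP e eqxx.
  have hQ Q : Q \in r' -> h r' (cover Q) = Q.
    move=> Qr; rewrite ffunE -e imset_f //; exact: partition_sub_cover cP rP Qr.
  split.
    apply/pfamilyP; split.
      by apply/subsetP => D; rewrite !inE ffunE; case: ifP => //; rewrite eqxx.
    move=> D; rewrite -e => /imsetP[Q Qr ->]; rewrite hQ //.
    apply/and3P; split => //.
      by apply: trivIsetS (partition_trivIset cP); exact: partitionS rP Qr.
    apply/negP => /(subsetP (partitionS rP Qr)).
    by rewrite (partition0 cP).
  apply/eqP; rewrite /h' -e -imset_comp -[RHS]imset_id.
  by apply: eq_in_imset => Q Qr /=; exact: hQ.
move=> /andP[hr' /eqP hK]; have [rP cP e finj _] := fP _ hr'.
rewrite hK in rP cP e.
by rewrite -[in RHS]hK /h' card_in_imset // big_imset.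
Qed.
End partition_sums.

Section cumulant_partitions.
Import mathcomp.boot.fintype mathcomp.boot.finset.
Context (R : realType) (d : measure_display) (Omega : measurableType d).
Variable P : probability Omega R.

(** The Möbius function of the partition lattice between a partition into [l] blocks and the
    one-block partition. *)
Definition cumulant_coef (l : nat) : R := (l.-1)`!%:R * (-1) ^+ l.-1.

Definition mixed_moment (T : finType) (X : T -> Omega -> R) (B : {set T}) : R :=
  fine ('E_P[(fun w => \prod_(i in B) X i w)%R])%E.

Lemma card_partition_bounds (T : finType) (C : {set T}) (pi : {set {set T}}) :
  (0 < #|C|)%N -> setpart pi C -> (0 < #|pi| <= #|C|)%N.
Proof.
move=> C0 piP; apply/andP; split.
  rewrite card_gt0; apply: contraTneq C0 => pi0.
  by rewrite -(cover_partition piP) pi0 /cover big_set0 cards0.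
rewrite (card_partition piP) -sum1_card; apply: leq_sum => B Bpi.
by rewrite card_gt0 (partition_neq0 piP).
Qed.

Lemma sum_partition_card (T : finType) (C : {set T}) (F : {set {set T}} -> R) :
  (0 < #|C|)%N ->
  \sum_(1 <= l < #|C|.+1) \sum_(pi | setpart pi C && (#|pi| == l)) F pi =
  \sum_(pi | setpart pi C) F pi.
Proof.
move=> C0; rewrite [RHS](partition_big (fun pi : {set {set T}} => inord #|pi|)
  (fun l : 'I_#|C|.+1 => (0 < l)%N)) /=; last first.
  move=> pi piP; have /andP[h1 h2] := card_partition_bounds C0 piP.
  by rewrite inordK.
rewrite big_add1 /= big_mkord [RHS]big_mkcond big_ord_recl /= add0r.
apply: eq_bigr => l _; apply: eq_bigl => pi.
apply: andb_id2l => piP; have /andP[h1 h2] := card_partition_bounds C0 piP.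
by rewrite -val_eqE /= inordK.
Qed.

Lemma joint_cumulantE n (X : 'I_n -> Omega -> R) : (0 < n)%N ->
  joint_cumulant P X = \sum_(pi | setpart pi [set: 'I_n])
    cumulant_coef #|pi| * \prod_(B in pi) mixed_moment X B.
Proof.
move=> n0; have c0 : (0 < #|[set: 'I_n]|)%N by rewrite cardsT card_ord.
rewrite -sum_partition_card // cardsT card_ord.
apply: eq_bigr => l _; rewrite mulr_sumr; apply: eq_bigr => pi /andP[_ /eqP <-].
by [].
Qed.

(** Transport along the injection [enum_val] rids the cumulant of the numbering of its arguments,
    which will be the blocks of a partition. *)
Lemma joint_cumulant_enum (T : finType) (A : {set T}) (Z : T -> Omega -> R) :
  (0 < #|A|)%N ->
  joint_cumulant P (fun j : 'I_#|A| => Z (enum_val j)) =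
  \sum_(rho | setpart rho A)
    cumulant_coef #|rho| * \prod_(Q in rho) mixed_moment Z Q.
Proof.
move=> A0; rewrite joint_cumulantE //.
pose e : 'I_#|A| -> T := enum_val.
have einj : injective e by exact: enum_val_inj.
have eT : e @: [set: 'I_#|A|] = A.
  apply/setP => x; apply/imsetP/idP => [[j _ ->]|xA]; first exact: enum_valP.
  by exists (enum_rank_in xA x) => //; rewrite /e enum_rankK_in.
pose h (r : {set {set 'I_#|A|}}) : {set {set T}} := [set e @: (B : {set _}) | B in r].
pose h' (r : {set {set T}}) : {set {set 'I_#|A|}} := [set e @^-1: (B : {set _}) | B in r].
have preK (B : {set 'I_#|A|}) : e @^-1: (e @: B) = B.
  by apply/setP => x; rewrite inE mem_imset.
have imK (B : {set T}) : B \subset A -> e @: (e @^-1: B) = B.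
  move=> sB; apply/setP => x; apply/imsetP/idP => [[j + ->]|xB]; first by rewrite inE.
  have xA : x \in A := subsetP sB _ xB.
  have xe : e (enum_rank_in xA x) = x by rewrite /e enum_rankK_in.
  by exists (enum_rank_in xA x) => //; rewrite inE xe.
rewrite [RHS](reindex_onto h h') /=; last first.
  move=> r rP; rewrite /h /h' -imset_comp -[RHS]imset_id.
  by apply: eq_in_imset => B Br /=; rewrite imK //; exact: partitionS rP Br.
apply: eq_big => [r|r rP].
  have -> : setpart (h r) A = setpart r [set: 'I_#|A|].
    by rewrite -[in LHS]eT imset_partition.
  rewrite /h /h' -imset_comp; apply/esym/andb_idr => _.
  by apply/eqP; rewrite -[RHS]imset_id; apply: eq_imset => B /=.
rewrite /h card_imset; last exact: imset_inj.
congr (_ * _); rewrite big_imset /=; last by move=> B B' _ _; exact: imset_inj.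
apply: eq_bigr => B _; congr (fine (expectation _ _)); apply/funext => w.
by rewrite big_imset //= => x y _ _; exact: einj.
Qed.

(** Once the moments of [X] are expanded, regrouping by the finer partition [pi] lets [rho] run over
    the partitions of the set [pi]. The coefficient depends on [#|rho|] only, so the inner sum is
    the cumulant of [Z] over the blocks of [pi]. *)
Lemma joint_cumulant_block_sum n (X : 'I_n -> Omega -> R)
    (Z : {set 'I_n} -> Omega -> R) : (0 < n)%N ->
  (forall C : {set 'I_n}, mixed_moment X C =
     \sum_(pi | setpart pi C) mixed_moment Z pi) ->
  joint_cumulant P X =
  \sum_(1 <= l < n.+1) \sum_(pi | setpart pi [set: 'I_n] && (#|pi| == l))
    joint_cumulant P (fun j : 'I_#|pi| => Z (enum_val j)).
Proof.
move=> n0 XZ; have c0 : (0 < #|[set: 'I_n]|)%N by rewrite cardsT card_ord.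
have -> : n.+1 = #|[set: 'I_n]|.+1 by rewrite cardsT card_ord.
rewrite sum_partition_card // joint_cumulantE //.
under eq_bigr do under eq_bigr do rewrite XZ.
rewrite sum_partition_coarsen; apply: eq_bigr => pi piP.
by rewrite joint_cumulant_enum //; case/andP: (card_partition_bounds c0 piP).
Qed.

End cumulant_partitions.

Section product_expansion.
Import mathcomp.boot.fintype mathcomp.boot.finset.

Lemma prodD_subsets (R : comNzRingType) (T : finType) (C : {set T}) (x : T)
    (a b : T -> R) : x \in C ->
  \prod_(i in C :\ x) (a i + b i) =
  \sum_(S : {set T} | (x \in S) && (S \subset C))
     (\prod_(i in S :\ x) a i) * \prod_(i in C :\: S) b i.
Proof.
move=> xC.
(* [F] and [G] force [x] into [S] and the complement of [C] out of it, so that the full distributive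
   law has only the wanted terms. *)
pose F i := if i \in C then (if i == x then 1 else a i) else 0.
pose G i := if i \in C then (if i == x then 0 else b i) else 1.
transitivity (\prod_i (F i + G i)).
  rewrite big_mkcond; apply: eq_bigr => i _; rewrite /F /G !inE.
  by case: eqP => [->|_] /=; rewrite ?xC ?addr0 //; case: ifP; rewrite ?add0r.
rewrite bigA_distr [RHS]big_mkcond; apply: eq_bigr => S _.
case: ifPn => [/andP[xS SC]|].
  rewrite [X in _ = X * _]big_mkcond [X in _ = _ * X]big_mkcond -big_split /=.
  apply: eq_bigr => i _; rewrite /F /G !inE.
  case: (boolP (i \in S)) => iS; first by rewrite (subsetP SC) //= andbT mulr1; case: eqP.
  rewrite andbF /= mul1r; case: ifP => // _; case: eqP => // ix.
  by rewrite ix xS in iS.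
rewrite negb_and => /orP[xS|/subsetPn[y yS yC]].
  by rewrite (bigD1 x) //= (negPf xS) /G xC eqxx mul0r.
by rewrite (bigD1 y) //= yS /F (negPf yC) mul0r.
Qed.
End product_expansion.

Local Open Scope classical_set_scope.

(** * Hop counts as sums over the last node *)

Section walks.
Context (R : realType).
Variable r : R.

(* [walks j] counts (j+1)-hops without requiring the nodes to be distinct; this
   makes it a plain iterated sum over the nodes. *)
Fixpoint walks (j : nat) (V : {fset R}) (x : R) : nat :=
  if j is i.+1 then (\sum_(y <- V | linked r y x) walks i V y)%N
  else linked r 0 x.

Lemma card_linked_tuples (V : {fset R}) j x :
  #|[set p : j.-tuple V | path (linked r) 0 (rcons [seq val y | y <- p] x)]%SET|
  = walks j V x.
Proof.
elim: j x => [|j IH] x /=.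
  rewrite (_ : [set p | _]%SET =
    if linked r 0 x then [set: 0.-tuple V]%SET else finset.set0); last first.
    by apply/setP => p; rewrite !inE (tuple0 p) /= andbT; case: ifP; rewrite inE.
  by case: ifP; rewrite ?finset.cardsT ?card_tuple ?finset.cards0.
rewrite big_seq_fsetE /= -sum1_card.
under [RHS]eq_bigr do rewrite -IH -sum1_card.
rewrite pair_big_dep /=.
(* Splitting off the last node is injective, and bijective by comparison of cardinalities. *)
pose h (u : V * j.-tuple V) : j.+1.-tuple V := [tuple of rcons u.2 u.1].
rewrite (reindex h) /=; last first.
  apply: onW_bij; apply: inj_card_bij => [[y q] [y' q'] /(congr1 val)/eqP|].
    by rewrite /= eqseq_rcons => /andP[/eqP/val_inj -> /eqP ->].
  by rewrite card_prod !card_tuple expnS.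
apply: eq_bigl => -[y q]; rewrite !inE /h /= map_rcons rcons_path last_rcons.
by rewrite andbC.
Qed.

(* When x >= (size p) r, the i-th node of [p] lies in [(i-1)r, ir], hence in the
   open cell if the grid is avoided. *)
Lemma linked_path_uniq (V : {fset R}) (p : seq R) x : 0 <= r ->
  {subset p <= V} -> (forall y, y \in V -> forall i : nat, y != i%:R * r) ->
  path (linked r) 0 (rcons p x) -> (size p)%:R * r <= x ->
  uniq p /\ (forall y, y \in p -> y < (size p)%:R * r).
Proof.
move=> r0 + ngrid; elim/last_ind: p x => [//|p y IH] x pV.
rewrite rcons_path last_rcons size_rcons => /andP[py yx] lx.
have path_le (q : seq R) (a b : R) :
    path (linked r) a (rcons q b) -> b <= a + (size q).+1%:R * r.
  elim: q a => [|c q IHq] a /=.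
    by rewrite andbT /linked mul1r ler_norml => /andP[_]; rewrite lerBlDl.
  rewrite /linked ler_norml => /andP[/andP[_ ca] /IHq bc].
  rewrite lerBlDl in ca; apply: (le_trans bc).
  by rewrite -[(size q).+2%:R]natr1 mulrDl mul1r; lra.
have ly : (size p)%:R * r <= y.
  move: yx lx; rewrite /linked ler_norml => /andP[_].
  by rewrite -natr1 mulrDl mul1r; lra.
have [|up ltp] := IH y _ py ly.
  by move=> z zp; apply: pV; rewrite mem_rcons inE zp orbT.
have yu : y < (size p).+1%:R * r.
  (* Avoiding the grid makes the bound on [y] strict; this separates [y] from the next node, which
     is at least that bound. *)
  rewrite lt_neqAle ngrid ?pV ?mem_rcons ?inE ?eqxx //=.
  by rewrite -[X in _ <= X]add0r; exact: path_le py.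
split.
  rewrite rcons_uniq up andbT; apply/negP => /ltp; by rewrite ltNge ly.
move=> z; rewrite mem_rcons inE => /orP[/eqP->//|/ltp]; move/lt_le_trans; apply.
by rewrite ler_wpM2r // ler_nat.
Qed.

Lemma hop_count_walks (V : {fset R}) j x : 0 <= r ->
  (forall y, y \in V -> forall i : nat, y != i%:R * r) -> j%:R * r <= x ->
  hop_count r V j.+1 x = walks j V x.
Proof.
move=> r0 ngrid jx; rewrite /hop_count -card_linked_tuples /=.
congr #|pred_of_set _|; apply/setP => p; rewrite !inE; apply/andb_idl => pp.
have := @linked_path_uniq V [seq val y | y <- p] x r0 _ ngrid pp.
rewrite size_map size_tuple => /(_ _ jx)[|+ _].
  by move=> z /mapP[y _ ->]; exact: valP.
by rewrite map_inj_uniq //; exact: val_inj.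
Qed.

Lemma walks_eq0 V j x : j.+1%:R * r < x -> walks j V x = 0%N.
Proof.
elim: j x => [|j IH] x /=.
  rewrite mul1r /linked subr0 => rx.
  by rewrite ler_norml [X in _ && X]leNgt rx andbF.
move=> jx; rewrite big1 // => y yx; apply: IH.
move: yx jx; rewrite /linked ler_norml => /andP[_].
by rewrite -[j.+2%:R]natr1 mulrDl mul1r; lra.
Qed.

(** A node beyond [j%:R * r] cannot be reached in [j] hops, so its term vanishes by [walks_eq0] when
    it is taken as last node, whatever the endpoint [x]. *)
Lemma walks_filter (V W : {fset R}) j x : 0 <= r ->
  (forall y, y <= j%:R * r -> (y \in V) = (y \in W)) ->
  walks j V x = walks j W x.
Proof.
move=> r0; elim: j x => [//|j IH] x VW /=.
have big_le (U : {fset R}) :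
    (\sum_(y <- U | linked r y x) walks j U y =
     \sum_(y <- [seq y <- U | (y <= j.+1%:R * r)%R] | linked r y x) walks j U y)%N.
  rewrite big_filter_cond (bigID (fun y => y <= j.+1%:R * r)) /= addnC big1.
    by rewrite add0n; apply: eq_bigl => y; rewrite andbC.
  by move=> y /andP[_]; rewrite -ltNge => /walks_eq0.
rewrite !big_le; apply: (etrans (perm_big [seq y <- W | y <= j.+1%:R * r] _)).
  apply: uniq_perm; rewrite ?filter_uniq ?fset_uniq // => y.
  by rewrite !mem_filter; apply: andb_id2l => /VW.
apply: eq_bigr => y _; apply: IH => z zj; apply: VW; apply: (le_trans zj).
by rewrite ler_wpM2r // ler_nat.
Qed.

Lemma walks_le (V : {fset R}) j x : (walks j V x <= #|` V| ^ j)%N.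
Proof.
elim: j x => [|j IH] x /=; first by case: linked.
rewrite expnS [X in (X * _)%N]card_fset_sum1 big_distrl /= big_mkcond; apply: leq_sum => y _.
by case: ifP => // _; rewrite mul1n IH.
Qed.

End walks.

(** * The measurable space of finite configurations *)

HB.instance Definition _ (R : realType) := isPointed.Build {fset R} fset0.

Section configurations.
Context (R : realType).

Definition fset_count (A : set R) (V : {fset R}) : nat :=
  #|` [fset x in V | x \in A]%fset|.

(** Arbitrary finite index types make this a π-system: intersections use the sum of two index types,
    and the whole space uses the empty one. Laws of configurations are thus determined by finite
    families of counts. *)
Definition count_cylinder : set (set {fset R}) :=
  [set E | exists (I : finType) (A : I -> set (measurableTypeR R)) (c : I -> nat),
    (forall i, measurable (A i)) /\
    E = [set V | forall i, fset_count (A i) V = c i]].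

Definition configs : Type := g_sigma_algebraType count_cylinder.

HB.instance Definition _ := Measurable.on configs.

Lemma fset_countE A (V : {fset R}) :
  fset_count A V = (\sum_(x <- V) (x \in A))%N.
Proof.
by rewrite /fset_count card_fset_sum1 -big_fset_condE big_mkcond.
Qed.

Lemma count_cylinderI : setI_closed count_cylinder.
Proof.
move=> _ _ [I [A [c [mA ->]]]] [J [B [e [mB ->]]]].
exists (I + J)%type, (fun u => match u with inl i => A i | inr j => B j end),
  (fun u => match u with inl i => c i | inr j => e j end).
split; first by case.
apply/seteqP; split => V /=; first by move=> [h1 h2] [i|j].
by move=> h; split => [i|j]; [exact: (h (inl i)) | exact: (h (inr j))].
Qed.

Lemma count_cylinderT : count_cylinder setT.
Proof.
exists void, (fun=> set0), (fun=> 0%N); split; first by case.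
by apply/seteqP; split => // V _ /= -[].
Qed.

Lemma measurable_configs d (S : measurableType d) (xi : S -> configs) :
  (forall A : set (measurableTypeR R), measurable A ->
    measurable_fun setT (fun s => fset_count A (xi s))) ->
  measurable_fun setT xi.
Proof.
move=> mxi; have := @measurability _ _ S configs setT xi count_cylinder. apply => //.
move=> _ [_ [I [A [c [mA ->]]]] <-]; rewrite setTI.
rewrite (_ : _ @^-1` _ = \bigcap_(i in [set: I])
   ((fun s => fset_count (A i) (xi s)) @^-1` [set c i])).
  apply: fin_bigcap_measurable => // i _; rewrite -[X in measurable X]setTI.
  exact: mxi.
by apply/seteqP; split => s /=; [move=> h i _; exact: h | move=> h i; exact: h].
Qed.

Lemma measurable_fset_count (A : set (measurableTypeR R)) : measurable A ->
  measurable_fun setT (fset_count A : configs -> nat).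
Proof.
move=> mA _ B _; rewrite setTI.
rewrite (_ : _ @^-1` _ = \bigcup_(n in B) [set V : configs | fset_count A V = n]).
  apply: bigcup_measurable => n _; apply: sub_sigma_algebra.
  exists unit, (fun=> A), (fun=> n); split => //.
  by apply/seteqP; split => V /=; [move=> h _ | move=> /(_ tt)].
by apply/seteqP; split => V /=; [move=> BV; exists (fset_count A V) | move=> [n Bn] ->].
Qed.

End configurations.

Local Open Scope ereal_scope.

Lemma measurable_nat_comp (d d' : measure_display) (S : measurableType d)
    (U : measurableType d') (g : nat -> U) (f : S -> nat) :
  measurable_fun setT f -> measurable_fun setT (g \o f).
Proof. by move=> mf; apply: measurableT_comp mf => _ B _. Qed.

Lemma fset_countT (R : realType) (V : {fset R}) : fset_count setT V = #|` V|.
Proof. by rewrite fset_countE card_fset_sum1; apply: eq_bigr => x _; rewrite in_setT. Qed.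

(** * Measurability of sums over the nodes *)

Section counting_kernel.
Context (R : realType) d (S : measurableType d) (xi : S -> configs R).
Hypothesis mxi : measurable_fun setT xi.
Local Notation RM := (measurableTypeR R).

Definition fset_measure (V : {fset R}) : {measure set RM -> \bar R} :=
  msum (fun i => \d_(nth 0%R V i : RM)) #|` V|.

Lemma fset_measureE (V : {fset R}) (A : set RM) : fset_measure V A = (fset_count A V)%:R%:E.
Proof.
rewrite fset_countE natr_sum -sumEFin (big_nth 0%R) big_mkord /= /msum /=.
by apply: eq_bigr => i _; rewrite diracE.
Qed.

Lemma integral_fset_measure (V : {fset R}) (f : RM -> \bar R) :
  measurable_fun [set: RM] f -> (forall x, 0 <= f x) ->
  \int[fset_measure V]_x f x = \sum_(x <- V) f x.
Proof.
move=> mf f0; rewrite ge0_integral_measure_sum //= (big_nth 0%R) big_mkord.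
by apply: eq_bigr => i _; rewrite integral_dirac // diracT mul1e.
Qed.

Definition counting_kernel (s : S) : {measure set RM -> \bar R} :=
  fset_measure (xi s).

Lemma measurable_counting_kernel U : measurable U ->
  measurable_fun setT (counting_kernel ^~ U).
Proof.
move=> mU; under eq_fun do rewrite /counting_kernel fset_measureE.
apply: (@measurable_nat_comp _ _ _ _ (fun n => n%:R%:E)).
exact: (measurableT_comp (measurable_fset_count mU)).
Qed.
HB.instance Definition _ := isKernel.Build _ _ S RM R counting_kernel
  measurable_counting_kernel.

(** The number of nodes is unbounded over configurations. Cutting by its value gives pieces of
    bounded mass, whose series shows that the counting kernel is s-finite. *)
Definition counting_kernel_card (n : nat) (s : S) : {measure set RM -> \bar R} :=
  if #|` (xi s : {fset R})| == n then fset_measure (xi s) else mzero.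

Lemma measurable_counting_kernel_card n U : measurable U ->
  measurable_fun setT (counting_kernel_card n ^~ U).
Proof.
move=> mU; have -> : counting_kernel_card n ^~ U =
    (fun s => if fset_count setT (xi s) == n then counting_kernel s U else 0).
  by apply/funext => s; rewrite fset_countT /counting_kernel_card; case: ifP.
apply: measurable_fun_ifT => //; last exact: measurable_counting_kernel.
apply: (@measurable_nat_comp _ _ _ _ (fun m => m == n)).
exact: (measurableT_comp (measurable_fset_count measurableT)).
Qed.
HB.instance Definition _ n := isKernel.Build _ _ S RM R (counting_kernel_card n)
  (@measurable_counting_kernel_card n).

Lemma counting_kernel_sfinite : exists2 s : (R.-ker S ~> RM)^nat,
    forall n, measure_fam_uub (s n) &
    forall x U, measurable U -> counting_kernel x U = kseries s x U.
Proof.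
exists (fun n => counting_kernel_card n) => [n|s U mU].
  exists n.+1%:R => s; rewrite /= /counting_kernel_card; case: ifPn => [/eqP <-|_].
    by rewrite fset_measureE fset_countT lte_fin ltr_nat.
  by rewrite /mzero lte_fin ltr0n.
rewrite -[RHS]/(\sum_(0 <= k <oo) counting_kernel_card k s U).
rewrite (@nneseriesD1 _ (fun k => counting_kernel_card k s U)
  #|` (xi s : {fset R})| xpredT) //.
rewrite {1}/counting_kernel_card eqxx eseries0 ?adde0 // => n _ /= ns.
by rewrite /counting_kernel_card eq_sym (negPf ns).
Qed.
HB.instance Definition _ := isSFiniteKernel_subdef.Build _ _ S RM R counting_kernel
  counting_kernel_sfinite.

(** The sum is the integral of [h] against an s-finite kernel, and such integrals depend measurably
    on the parameter. *)
Lemma measurable_fset_sum (h : S * RM -> \bar R) :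
  measurable_fun setT h -> (forall u, 0 <= h u) ->
  measurable_fun setT (fun s => \sum_(y <- (xi s : {fset R})) h (s, y)).
Proof.
move=> mh h0.
have := measurable_fun_integral_sfinite_kernel h counting_kernel h0 mh.
apply: eq_measurable_fun => s _; rewrite integral_fset_measure //.
by apply: measurableT_comp.
Qed.

End counting_kernel.

Lemma measurable_linked (R : realType) (r : R) d (S : measurableType d)
    (f g : S -> R) : measurable_fun setT f -> measurable_fun setT g ->
  measurable_fun setT (fun s => linked r (f s) (g s)).
Proof.
move=> mf mg; apply: measurable_fun_ler; last exact: measurable_cst.
by apply: measurableT_comp => //; apply: measurable_funB.
Qed.

Lemma measurable_walks (R : realType) (r : R) j :
  measurable_fun setT (fun u : configs R * measurableTypeR R =>
    (walks r j (u.1 : {fset R}) u.2)%:R%:E : \bar R).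
Proof.
elim: j => [|j IH] /=.
  apply: (@measurable_nat_comp _ _ _ _ (fun n => n%:R%:E)).
  apply: (measurableT_comp (f := nat_of_bool)) => //.
  by apply: measurable_linked => //; exact: measurable_cst.
pose S := (configs R * measurableTypeR R)%type.
pose h (v : S * measurableTypeR R) : \bar R :=
  if linked r v.2 v.1.2 then (walks r j (v.1.1 : {fset R}) v.2)%:R%:E else 0.
have mh : measurable_fun setT h.
  apply: measurable_fun_ifT => //.
    by apply: measurable_linked => //; exact: measurableT_comp.
  apply: (measurableT_comp IH (g := fun v : S * measurableTypeR R => (v.1.1, v.2))).
  apply: measurable_fun_pair => //; exact: measurableT_comp.
have h0 v : 0 <= h v by rewrite /h; case: ifP.
have := @measurable_fset_sum R _ S (fun u => u.1) measurable_fst h mh h0.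
apply: eq_measurable_fun => u _.
by rewrite natr_sum -sumEFin [RHS]big_mkcond.
Qed.

(** * Counts and moments of a Poisson process *)

Section countable_range.
Context (R : realType) d (S : measurableType d) (mu : {measure set S -> \bar R}).
Context (C : countType) (N : S -> C).
Hypothesis mN : forall c, measurable [set s | N s = c].

Let fiber n := [set s | choice.pickle (N s) = n].

Let mfiber n : measurable (fiber n).
Proof.
have [[s sn]|nn] := pselect (exists s, fiber n s).
  rewrite (_ : fiber n = [set s' | N s' = N s]) //.
  apply/seteqP; split => s' /=; rewrite /fiber /= -sn; last by move=> ->.
  by move/(pcan_inj choice.pickleK).
rewrite (_ : fiber n = set0) //; apply/seteqP; split => // s sn.
by apply: nn; exists s.
Qed.

(** Preimages are countable unions of fibres of [N]; [C] carries no sigma-algebra, so [f] may be any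
    function. *)
Lemma measurable_countable_comp d' (U : measurableType d') (f : C -> U) :
  measurable_fun setT (fun s => f (N s)).
Proof.
move=> _ B mB; rewrite setTI.
rewrite (_ : _ @^-1` _ = \bigcup_n (fiber n `&` [set s | B (f (N s))])); last first.
  apply/seteqP; split => s /=; first by move=> h; exists (choice.pickle (N s)).
  by move=> [n _ []].
apply: bigcup_measurable => n _.
have [[s [sn Bs]]|nn] := pselect (exists s, fiber n s /\ B (f (N s))).
  rewrite (_ : _ `&` _ = fiber n) //; apply/seteqP; split => s'; first by case.
  move=> s'n; split => //=; suff -> : N s' = N s by [].
  by apply: (pcan_inj choice.pickleK); rewrite s'n sn.
rewrite (_ : _ `&` _ = set0) //; apply/seteqP; split => // s [sn Bs].
by apply: nn; exists s.
Qed.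

Lemma integral_countable_comp (f : C -> \bar R) : (forall c, 0 <= f c) ->
  \int[mu]_s f (N s) = \esum_(c in setT) (f c * mu [set s | N s = c]).
Proof.
move=> f0.
have TU : [set: S] = \bigcup_n fiber n.
  by apply/seteqP; split => s // _; exists (choice.pickle (N s)).
rewrite TU ge0_integral_bigcup //; last 2 first.
- by rewrite -TU; exact: measurable_countable_comp.
- apply/trivIsetP => i j _ _ ij; apply/seteqP; split => // s [si sj];
  by move: ij; rewrite -[i]si -[j]sj eqxx.
pose g n := if @pickle_inv C n is Some c then f c * mu [set s | N s = c] else 0.
have g0 n : 0 <= g n by rewrite /g; case: pickle_inv => // c; rewrite mule_ge0.
transitivity (\sum_(0 <= n <oo) g n).
  apply: eq_eseriesr => n _; rewrite /g.
  case E : (@pickle_inv C n) => [c|].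
    have cn : choice.pickle c = n by have := @pickle_invK C n; rewrite E.
    have -> : fiber n = [set s | N s = c].
      apply/seteqP; split => s /=; rewrite /fiber /= -cn; last by move=> ->.
      by move/(pcan_inj choice.pickleK).
    rewrite (eq_integral (cst (f c))) ?integral_cst //.
    by move=> s; rewrite inE /= => ->.
  rewrite (_ : fiber n = set0) ?integral_set0 //.
  by apply/seteqP; split => // s /= sn; rewrite -sn pickleK_inv in E.
rewrite nneseries_esumT //.
transitivity (\esum_(n in [set choice.pickle c | c in [set: C]]) g n).
  rewrite [RHS]esum_mkcond; apply: eq_esum => n _; case: ifPn => // nC.
  rewrite /g; case E : (@pickle_inv C n) => [c|//]; case/negP: nC; rewrite inE.
  by exists c => //; have := @pickle_invK C n; rewrite E.
rewrite (reindex_esum [set: C] _ choice.pickle).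
  by apply: eq_esum => c _; rewrite /g pickleK_inv.
split=> [c _|x y _ _|_ [c _ <-]]; [by exists c | exact: (pcan_inj choice.pickleK) | by exists c].
Qed.

End countable_range.

Section poisson_counts.
Context (R : realType) d (Omega : measurableType d) (P : probability Omega R).
Context (D : set R) (Lambda : set R -> \bar R) (eta : Omega -> {fset R}).
Hypothesis heta : poisson_process P D Lambda eta.
Hypothesis Lambda_ge0 : forall A, 0 <= Lambda A.
Local Notation RM := (measurableTypeR R).

Definition poisson_mass (m : R) (c : nat) : R :=
  (m ^+ c / c`!%:R * expR (- m))%R.

Lemma measurable_eta : measurable_fun setT (eta : Omega -> configs R).
Proof. by case: heta => _ h _ _; apply: measurable_configs => A /h. Qed.

Context (I : finType) (A : I -> set RM).
Hypothesis mA : forall i, measurable (A i).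

Definition counts (w : Omega) : {ffun I -> nat} :=
  [ffun i => fset_count (A i) (eta w)].

Lemma countsE c : [set w | counts w = c] =
  [set w | forall i, fset_count (A i) (eta w) = c i].
Proof.
apply/seteqP; split => w /=; first by move=> <- i; rewrite ffunE.
by move=> h; apply/ffunP => i; rewrite ffunE.
Qed.

Lemma measurable_counts c : measurable [set w | counts w = c].
Proof.
rewrite countsE (_ : mkset _ = \bigcap_(i in [set: I])
   ((fun w => fset_count (A i) (eta w)) @^-1` [set c i])).
  apply: fin_bigcap_measurable => // i _; rewrite -[X in measurable X]setTI.
  by case: heta => _ h _ _; exact: h.
by apply/seteqP; split => s /=; [move=> h i _; exact: h | move=> h i; exact: h].
Qed.

Hypothesis dA : forall i j, i != j -> A i `&` A j = set0.

Lemma counts_law c : P [set w | counts w = c] =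
  (\prod_(i : I) poisson_mass (fine (Lambda (A i))) (c i))%:E.
Proof.
case: heta => _ _ hpois hind; rewrite countsE.
have dj (j k : 'I_#|I|) : j != k -> A (enum_val j) `&` A (enum_val k) = set0.
  by move=> jk; apply: dA; apply: contra jk => /eqP/enum_val_inj ->.
have := hind #|I| (fun j => A (enum_val j)) (fun j => c (enum_val j)) (fun j => mA _) dj.
rewrite (_ : [set w | forall i, _] = [set w | forall i, fset_count (A i) (eta w) = c i]).
  move=> ->; rewrite [in RHS](reindex (enum_val : 'I_#|I| -> I)) /=; last first.
    exact/onW_bij/enum_val_bij.
  by rewrite -prodEFin; apply: eq_bigr => j _; exact: hpois.
apply/seteqP; split => w /= h i; last exact: h.
by rewrite -(enum_rankK i); exact: h.
Qed.

(** Size biasing of one coordinate: [c m^c / c! = m m^(c-1) / (c-1)!], the other coordinates being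
    independent of it. This is Mecke's formula for functions of the cell counts, the unit added at
    [a] being the added node. *)
Lemma poisson_mecke a (f : {ffun I -> nat} -> \bar R) : (forall c, 0 <= f c) ->
  \int[P]_w ((counts w a)%:R%:E * f (counts w)) =
  (fine (Lambda (A a)))%:E *
    \int[P]_w f [ffun i => (counts w i + (i == a))%N].
Proof.
move=> f0.
pose e (c : {ffun I -> nat}) : {ffun I -> nat} := [ffun i => (c i + (i == a))%N].
pose m i := fine (Lambda (A i)).
have m0 i : (0 <= m i)%R by apply: fine_ge0.
rewrite (@integral_countable_comp R _ _ _ _ counts _ (fun c => (c a)%:R%:E * f c)).
- rewrite -ge0_integralZl_EFin //; last 2 first.
  + exact: (@measurable_countable_comp _ _ _ counts measurable_counts _ _ (fun c => f (e c))).
  + exact: m0.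
  rewrite (@integral_countable_comp R _ _ _ _ counts _ (fun c => (m a)%:E * f (e c))).
  (* Outside the image of [e] the count at [a] is 0, and the term vanishes. *)
  + transitivity (\esum_(c in [set e c | c in [set: {ffun I -> nat}]])
       ((c a)%:R%:E * f c * P [set s | counts s = c])).
      rewrite [RHS]esum_mkcond; apply: eq_esum => c _; case: ifPn => // cE.
      suff -> : c a = 0%N by rewrite !mul0e.
      apply/eqP; apply: contraNT cE => ca; rewrite inE /=.
      exists [ffun i => (c i - (i == a))%N] => //; apply/ffunP => i.
      rewrite !ffunE; case: eqP => [->|_]; last by rewrite subn0 addn0.
      by rewrite subnK // lt0n.
    rewrite (reindex_esum [set: {ffun I -> nat}] _ e); last first.
      split=> [c _|x y _ _ /ffunP xy|_ [c _ <-]]; [by exists c| |by exists c].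
      by apply/ffunP => i; have := xy i; rewrite !ffunE => /addIn.
    apply: eq_esum => c _; rewrite [_%:R%:E * _]muleC [(m a)%:E * _]muleC -!muleA.
    congr (_ * _).
    rewrite (counts_law (e c)) -[X in _ = _ * X]/(P [set w | counts w = c]).
    rewrite (counts_law c) -!EFinM; congr EFin.
    rewrite (bigD1 a) //= [in RHS](bigD1 a) //= !mulrA; congr (_ * _)%R; last first.
      by apply: eq_bigr => i ia; rewrite ffunE (negPf ia) addn0.
    rewrite ffunE eqxx addn1 /poisson_mass -/(m a); congr (_ * _)%R.
    rewrite exprS factS natrM; field.
    by rewrite nat1r !pnatr_eq0 -lt0n fact_gt0.
  + exact: measurable_counts.
  + by move=> c; rewrite mule_ge0 // lee_fin.
- exact: measurable_counts.
- by move=> c; rewrite mule_ge0 // lee_fin.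
Qed.

End poisson_counts.

(** * Mixed moments of sums over Poisson nodes *)

Section poisson_moments.
Context (R : realType) d (Omega : measurableType d) (P : probability Omega R).
Context (D : set R) (dens : R -> R) (eta : Omega -> {fset R}).
Local Notation RM := (measurableTypeR R).
Local Notation mu := (@lebesgue_measure R).
Hypothesis dens0 : forall x, (0 <= dens x)%R.
Hypothesis idens : mu.-integrable setT (EFin \o dens).
Hypothesis heta : poisson_process P D
  (fun A => \int[mu]_(x in A) (dens x)%:E) eta.
Context (I : finType) (f : I -> R -> nat) (J : nat).
Hypothesis mf : forall i, measurable_fun [set: RM] (f i : RM -> nat).
Hypothesis fJ : forall i x, (f i x <= J)%N.

Local Notation lev := {ffun I -> 'I_J.+1}.

Let mdens : measurable_fun [set: RM] (dens : RM -> R).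
Proof. by apply/measurable_EFinP; exact: measurable_int idens. Qed.

(** Every [f i] takes values in 0..J, so the line splits into finitely many disjoint sets on which
    all [f i] are constant. Sums of [f i] over the nodes become linear forms, called [X i] below, in
    independent Poisson counts. *)
Definition level_set (v : lev) : set RM := [set x | forall i, f i x = v i].

Lemma measurable_level_set v : measurable (level_set v).
Proof.
rewrite (_ : level_set v = \bigcap_(i in [set: I]) (f i @^-1` [set (v i : nat)])).
  apply: fin_bigcap_measurable => // i _; rewrite -[X in measurable X]setTI.
  exact: mf.
by apply/seteqP; split => s /=; [move=> h i _; exact: h | move=> h i; exact: h].
Qed.

Lemma level_set_disj v u : v != u -> level_set v `&` level_set u = set0.
Proof.
move=> vu; apply/seteqP; split => // x [hv hu]; move: vu; apply/negP; rewrite negbK.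
by apply/eqP/ffunP => i; apply/val_inj; rewrite /= -hv -hu.
Qed.

Definition level (x : R) : lev := [ffun i => inord (f i x)].

Lemma mem_level_set x v : (x \in level_set v) = (v == level x).
Proof.
apply/idP/eqP => [|->]; rewrite inE /level_set /=.
  by move=> h; apply/ffunP => i; apply: val_inj; rewrite ffunE /= inordK ?ltnS // h.
by move=> i; rewrite ffunE inordK ?ltnS.
Qed.

Lemma sum_level_set (S : nmodType) (F : lev -> S) x :
  (\sum_(v : lev) F v *+ (x \in level_set v) = F (level x))%R.
Proof.
rewrite (bigD1 (level x)) //= mem_level_set eqxx mulr1n big1 ?addr0 // => v vx.
by rewrite mem_level_set (negPf vx) mulr0n.
Qed.

Definition fset_total (i : I) (V : {fset R}) : nat := (\sum_(x <- V) f i x)%N.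

Let X (i : I) (c : {ffun lev -> nat}) : R := (\sum_(v : lev) (v i)%:R * (c v)%:R)%R.

Let fset_totalE i w :
  (fset_total i (eta w))%:R%R = X i (counts eta level_set w).
Proof.
rewrite /X; under eq_bigr do rewrite ffunE fset_countE natr_sum mulr_sumr.
rewrite exchange_big /= natr_sum; apply: eq_bigr => x _.
under eq_bigr do rewrite mulr_natr.
by rewrite (sum_level_set (fun v => (v i)%:R%R)) ffunE inordK ?ltnS.
Qed.

Let XD i (c : {ffun lev -> nat}) (a : lev) :
  X i [ffun v => (c v + (v == a))%N] = (X i c + (a i)%:R)%R.
Proof.
rewrite /X; under eq_bigr do rewrite ffunE natrD mulrDr.
rewrite big_split /=; congr (_ + _)%R; rewrite (bigD1 a) //= eqxx mulr1 big1 ?addr0 //.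
by move=> v va; rewrite (negPf va) mulr0.
Qed.

Definition weight (B : {set I}) : R :=
  fine (\int[mu]_x ((\prod_(i in B) (f i x)%:R) * dens x)%:E).

Let m (v : lev) : R := fine (\int[mu]_(x in level_set v) (dens x)%:E).

Let weightE B : weight B = (\sum_(v : lev) (\prod_(i in B) (v i)%:R) * m v)%R.
Proof.
rewrite /weight; transitivity (fine (\sum_(v : lev) \int[mu]_x
   ((\prod_(i in B) (v i)%:R)%:E * (EFin \o dens \_ (level_set v)) x))).
  congr fine; rewrite -ge0_integral_sum //=; last 2 first.
  - move=> v; apply: emeasurable_funM; first exact: measurable_cst.
    apply/measurable_EFinP; apply/(measurable_restrictT _ (measurable_level_set v)).
    exact: measurable_funTS mdens.
  - move=> v x _; rewrite -EFinM lee_fin mulr_ge0 ?prodr_ge0 //.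
    by rewrite patchE; case: ifP.
  apply: eq_integral => x _; rewrite sumEFin; congr EFin.
  transitivity (\sum_(v : lev)
      ((\prod_(i in B) (v i)%:R) * dens x) *+ (x \in level_set v))%R.
    rewrite sum_level_set; congr (_ * _)%R; apply: eq_bigr => i _.
    by rewrite ffunE inordK ?ltnS.
  apply: eq_bigr => v _; rewrite patchE.
  by case: ifP => _; rewrite ?mulr0n ?mulr0.
rewrite -[RHS]/(fine (_ %:E)) -sumEFin; congr fine; apply: eq_bigr => v _.
rewrite ge0_integralZl_EFin //; last 3 first.
- by move=> x _; rewrite /= lee_fin patchE; case: ifP.
- apply/measurable_EFinP; apply/(measurable_restrictT _ (measurable_level_set v)).
  exact: measurable_funTS mdens.
- exact: prodr_ge0.
rewrite EFinM /m fineK.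
  congr (_ * _); rewrite [RHS]integral_mkcond; apply: eq_integral => x _.
  by rewrite /= !patchE; case: ifP.
apply: integrable_fin_num; first exact: measurable_level_set.
by apply: integrableS idens => //; exact: measurable_level_set.
Qed.

(** Induction on [#|C|]. The factor of some [x] is opened into counts of level sets; Mecke's formula
    trades such a count for an added node, which changes every other factor [X i] into [X i + v i].
    When this product is expanded, the indices that use the added node form, with [x], the block of
    [x]. *)
Lemma poisson_moments (C : {set I}) :
  \int[P]_w (\prod_(i in C) (fset_total i (eta w))%:R)%:E =
  (\sum_(pi | setpart pi C) \prod_(B in pi) weight B)%:E.
Proof.
have [n] := ubnP #|C|; elim: n C => // n IH C; rewrite ltnS => Cn.
have [->|/set0Pn[x xC]] := eqVneq C finset.set0.
  transitivity (\int[P]_w (cst 1%:E w)).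
    by apply: eq_integral => w _; rewrite finset.big_set0.
  rewrite integral_cst // mul1e [LHS]probability_setT (big_pred1 finset.set0).
    by rewrite finset.big_set0.
  by move=> pi /=; rewrite partition_set0.
pose M (B : {set I}) : R := (\sum_(pi | setpart pi B) \prod_(B in pi) weight B)%R.
rewrite (sum_partition_pblock _ xC).
pose N w := counts eta level_set w.
have mN c : measurable [set w | N w = c].
  exact: (measurable_counts heta measurable_level_set).
pose g (B : {set I}) (c : {ffun lev -> nat}) : \bar R := (\prod_(i in B) X i c)%:E.
have X0 i c : (0 <= X i c)%R by apply: sumr_ge0 => v _; rewrite mulr_ge0.
have g0 B c : 0 <= g B c by rewrite lee_fin prodr_ge0.
have mg h : measurable_fun setT (fun w => h (N w) : \bar R).
  exact: (measurable_countable_comp mN).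
have IHg (B : {set I}) : (#|B| < n)%N -> \int[P]_w g B (N w) = (M B)%:E.
  move=> Bn; rewrite -[RHS](IH _ Bn); apply: eq_integral => w _.
  by congr EFin; apply: eq_bigr => i _; rewrite fset_totalE.
transitivity (\int[P]_w (\sum_(v : lev)
    (v x)%:R%:E * ((N w v)%:R%:E * g (C :\ x)%SET (N w)))).
  apply: eq_integral => w _; rewrite /g.
  under [RHS]eq_bigr do rewrite -!EFinM.
  rewrite sumEFin; congr EFin.
  under [LHS]eq_bigr do rewrite fset_totalE.
  rewrite (big_setD1 x) //= {1}/X mulr_suml.
  by apply: eq_bigr => v _; rewrite mulrA.
rewrite ge0_integral_sum //=; last 2 first.
- by move=> v; exact: (mg (fun c => (v x)%:R%:E * ((c v)%:R%:E * g (C :\ x)%SET c))).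
- by move=> v w _; rewrite !mule_ge0 // lee_fin.
transitivity (\sum_(v : lev) ((v x)%:R * (m v *
   \sum_(S : {set I} | (x \in S) && (S \subset C))
     (\prod_(i in (S :\ x)%SET) (v i)%:R * M (C :\: S)%SET)))%:E)%R.
  apply: eq_bigr => v _.
  rewrite ge0_integralZl_EFin //; last 2 first.
  - by move=> w _; rewrite mule_ge0 // lee_fin.
  - exact: (mg (fun c => (c v)%:R%:E * g (C :\ x)%SET c)).
  rewrite EFinM; congr (_ * _).
  rewrite (poisson_mecke heta) //; last 3 first.
  - by move=> A; apply: integral_ge0 => y _; rewrite lee_fin.
  - exact: measurable_level_set.
  - exact: level_set_disj.
  rewrite EFinM; congr (_ * _).
  transitivity (\int[P]_w (\sum_(S : {set I} | (x \in S) && (S \subset C))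
     ((\prod_(i in (S :\ x)%SET) (v i)%:R)%:E * g (C :\: S)%SET (N w)))).
    apply: eq_integral => w _; rewrite /g.
    under [RHS]eq_bigr do rewrite -EFinM.
    rewrite sumEFin -prodD_subsets //; congr EFin; apply: eq_bigr => i _.
    by rewrite XD addrC.
  under eq_integral do rewrite -big_filter.
  rewrite ge0_integral_sum //=; last 2 first.
  - move=> S.
    exact: (mg (fun c => (\prod_(i in (S :\ x)%SET) (v i)%:R)%:E * g (C :\: S)%SET c)).
  - by move=> S w _; rewrite mule_ge0 // lee_fin prodr_ge0.
  rewrite big_filter -sumEFin; apply: eq_bigr => S /andP[xS SC].
  rewrite ge0_integralZl_EFin //; last by apply: prodr_ge0.
  rewrite IHg //; apply: leq_trans Cn; apply: proper_card; apply/properP.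
  by split; [exact: subsetDl | exists x => //; rewrite !inE xS].
rewrite sumEFin; congr EFin.
under [LHS]eq_bigr do rewrite !mulr_sumr.
rewrite exchange_big /=; apply: eq_bigr => S /andP[xS SC].
rewrite -/(M (C :\: S)%SET) weightE mulr_suml; apply: eq_bigr => v _.
rewrite [in RHS](big_setD1 x) //=; ring.
Qed.
End poisson_moments.

(** * Independence of disjoint regions *)

Section equality_of_laws.
Context (R : realType) (d1 d2 : measure_display).
Context (S1 : measurableType d1) (S2 : measurableType d2).
Context (P1 : probability S1 R) (P2 : probability S2 R).
Context (xi1 : S1 -> configs R) (xi2 : S2 -> configs R).
Hypothesis mxi1 : measurable_fun setT xi1.
Hypothesis mxi2 : measurable_fun setT xi2.
Local Notation RM := (measurableTypeR R).

Lemma configs_law_eq (Psi : configs R -> \bar R) :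
  (forall (I : finType) (A : I -> set RM) (c : I -> nat),
    (forall i, measurable (A i)) ->
    P1 [set w | forall i, fset_count (A i) (xi1 w) = c i] =
    P2 [set w | forall i, fset_count (A i) (xi2 w) = c i]) ->
  measurable_fun setT Psi -> (forall V, 0 <= Psi V) ->
  \int[P1]_w Psi (xi1 w) = \int[P2]_w Psi (xi2 w).
Proof.
move=> P12 mPsi Psi0.
rewrite -[LHS](ge0_integral_pushforward mxi1 P1 measurableT mPsi) //.
rewrite -[RHS](ge0_integral_pushforward mxi2 P2 measurableT mPsi) //.
pose f1 : {measure set (configs R) -> \bar R} := pushforward P1 xi1.
pose m1 := f1 mxi1.
pose f2 : {measure set (configs R) -> \bar R} := pushforward P2 xi2.
pose m2 := f2 mxi2.
rewrite -[LHS]/(\int[m1]_y Psi y) -[RHS]/(\int[m2]_y Psi y).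
apply: eq_measure_integral => A mA _.
apply: (@measure_unique _ _ (configs R) (@count_cylinder R) (fun=> setT)) => //.
- exact: count_cylinderI.
- by move=> _; exact: count_cylinderT.
- by rewrite bigcup_const.
- by move=> _ [I [B [c [mB ->]]]]; exact: P12.
- by move=> _; rewrite /m1 /= /pushforward preimage_setT probability_setT ltry.
Qed.

End equality_of_laws.

Section laws_on_atoms.
Context (R : realType).
Local Notation RM := (measurableTypeR R).
Context (I : finType) (A : I -> set RM) (L : set RM).
Hypothesis (mA : forall i, measurable (A i)) (mL : measurable L).

(** Poisson independence concerns disjoint sets, whereas cylinders use arbitrary families. The atoms
    are the cells of the partition generated by [A] and [L]: each lies inside [L] or outside it, and
    the counts over the [A i] are sums of atom counts. *)
Definition atom (k : {ffun I -> bool} * bool) : set RM :=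
  [set x | (forall i, (x \in A i) = k.1 i) /\ (x \in L) = k.2].

Lemma measurable_atom k : measurable (atom k).
Proof.
have mb (B : set RM) (b : bool) : measurable B -> measurable [set x | (x \in B) = b].
  move=> mB; case: b.
    rewrite (_ : mkset _ = B) //.
    by apply/seteqP; split => x /=; [move=> /set_mem | move=> /mem_set].
  rewrite (_ : mkset _ = ~` B); first exact: measurableC.
  apply/seteqP; split => x /=; first by move/negbT; rewrite notin_setE.
  by move=> h; apply/negbTE; rewrite notin_setE.
rewrite (_ : atom k = (\bigcap_(i in [set: I]) [set x | (x \in A i) = k.1 i]) `&`
    [set x | (x \in L) = k.2]).
  apply: measurableI; last exact: mb.
  by apply: fin_bigcap_measurable => // i _; exact: mb.
apply/seteqP; split => x /= [h1 h2]; split => // i; first by move=> _; exact: h1.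
exact: h1.
Qed.

Lemma atom_disj k l : k != l -> atom k `&` atom l = set0.
Proof.
case: k l => [b z] [b' z'] kl; apply/seteqP; split => // x [[/= h1 h2] [/= h3 h4]].
case/eqP: kl; rewrite -h2 h4; congr pair; apply/ffunP => i.
by rewrite -h1 h3.
Qed.

Lemma fset_count_atoms i (V : {fset R}) :
  fset_count (A i) V = (\sum_(k : {ffun I -> bool} * bool | k.1 i) fset_count (atom k) V)%N.
Proof.
under eq_bigr do rewrite fset_countE.
rewrite exchange_big fset_countE /=; apply: eq_bigr => x _.
pose k0 : {ffun I -> bool} * bool := ([ffun i => x \in A i], x \in L).
have kE k : (x \in atom k) = (k == k0).
  apply/idP/eqP => [|->]; rewrite inE.
    by case: k => b z [/= h1 h2]; rewrite /k0 h2; congr pair; apply/ffunP => j; rewrite ffunE h1.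
  by split => //= j; rewrite ffunE.
rewrite big_mkcond (bigD1 k0) //= ffunE kE eqxx big1 ?addn0; first by case: ifP.
by move=> k kk0; rewrite kE (negPf kk0); case: ifP.
Qed.

End laws_on_atoms.

Section superposition.
Context (R : realType) d (Omega : measurableType d) (P : probability Omega R).
Local Notation RM := (measurableTypeR R).
Context (L : set RM) (mL : measurable L).
Context (D1 D2 : set R) (Lambda1 Lambda2 : set R -> \bar R).
Context (eta1 eta2 : Omega -> {fset R}).
Hypothesis heta1 : poisson_process P D1 Lambda1 eta1.
Hypothesis heta2 : poisson_process P D2 Lambda2 eta2.
Hypothesis Lambda12 : forall A, A `<=` L -> Lambda1 A = Lambda2 A.

(* Nodes in [L] and outside [L] are drawn from two independent copies of the
   probability space. *)
Definition glue (w : Omega * Omega) : configs R :=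
  ([fset x in eta1 w.1 | x \in L] `|` [fset x in eta2 w.2 | x \notin L])%fset.

Lemma fset_count_glue A w : fset_count A (glue w) =
  (fset_count (A `&` L) (eta1 w.1) + fset_count (A `&` ~` L) (eta2 w.2))%N.
Proof.
rewrite /fset_count /glue -cardfsUI [X in (_ + X)%N](_ : _ = 0%N).
  rewrite addn0; congr #|` _|; apply/fsetP => x; rewrite !inE.
  by rewrite !in_setI in_setC; case: (x \in A); rewrite ?andbT ?andbF.
apply/eqP; rewrite cardfs_eq0; apply/eqP/fsetP => x; rewrite !inE.
by rewrite !in_setI in_setC; case: (x \in L); rewrite ?andbF ?andFb.
Qed.

Lemma measurable_glue : measurable_fun setT glue.
Proof.
apply: measurable_configs => A mA.
under eq_fun do rewrite fset_count_glue.
have mc1 : measurable_fun setT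
    (fun w : Omega * Omega => fset_count (A `&` L) (eta1 w.1)).
  apply: (measurableT_comp (measurable_fset_count (measurableI _ _ mA mL))).
  exact: (measurableT_comp (measurable_eta heta1)).
have mc2 : measurable_fun setT
    (fun w : Omega * Omega => fset_count (A `&` ~` L) (eta2 w.2)).
  apply: (measurableT_comp (measurable_fset_count (measurableI _ _ mA (measurableC mL)))).
  exact: (measurableT_comp (measurable_eta heta2)).
apply: (@measurable_countable_comp _ _ (nat * nat)%type
  (fun w => (fset_count (A `&` L) (eta1 w.1), fset_count (A `&` ~` L) (eta2 w.2)))
  _ _ _ (fun u => (u.1 + u.2)%N)) => -[m n].
rewrite (_ : mkset _ = ((fun w => fset_count (A `&` L) (eta1 w.1)) @^-1` [set m]) `&`
  ((fun w => fset_count (A `&` ~` L) (eta2 w.2)) @^-1` [set n])).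
  by apply: measurableI; rewrite -[X in measurable X]setTI; [exact: mc1 | exact: mc2].
by apply/seteqP; split => w /=; [case=> -> -> | case=> -> ->].
Qed.

Lemma fset_count_atom_glue (I : finType) (A : I -> set RM) k w :
  fset_count (atom A L k) (glue w) =
  if k.2 then fset_count (atom A L k) (eta1 w.1)
  else fset_count (atom A L k) (eta2 w.2).
Proof.
have count0 (V : {fset R}) : fset_count set0 V = 0%N.
  by rewrite fset_countE big1 // => x _; rewrite in_set0.
rewrite fset_count_glue; case: ifP => k2.
  have sub : atom A L k `<=` L by move=> x [_]; rewrite k2 => /set_mem.
  rewrite setIidl // (_ : _ `&` ~` L = set0) ?count0 ?addn0 //.
  by apply/seteqP; split => // x [/sub].
have sub : atom A L k `<=` ~` L by move=> x [_]; rewrite k2 => /negbT; rewrite notin_setE.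
rewrite [X in (_ + fset_count X _)%N]setIidl // (_ : _ `&` L = set0) ?count0 //.
by apply/seteqP; split => // x [/sub].
Qed.

(** An atom sees only one of the two copies. Both sides are products of Poisson masses, which agree
    factor by factor because [Lambda1] and [Lambda2] coincide inside [L]. *)
Lemma glue_atoms_law (I : finType) (A : I -> set RM) (c : _ -> nat) :
  (forall i, measurable (A i)) ->
  P [set w | forall k, fset_count (atom A L k) (eta2 w) = c k] =
  (P \x P) [set w | forall k, fset_count (atom A L k) (glue w) = c k].
Proof.
move=> mA; have ma := measurable_atom mA mL.
have da k l : k != l -> atom A L k `&` atom A L l = set0 by exact: atom_disj.
rewrite (_ : [set w | forall k, fset_count (atom A L k) (eta2 w) = c k] =
  [set w | counts eta2 (atom A L) w = finfun c]); last first.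
  by rewrite countsE; apply/seteqP; split => w /= h k; rewrite ?ffunE // h ffunE.
rewrite (counts_law heta2 ma da).
pose e z (b : {ffun I -> bool}) := atom A L (b, z).
have me z b : measurable (e z b) by exact: ma.
have de z b b' : b != b' -> e z b `&` e z b' = set0.
  by move=> bb'; apply: da; apply: contra bb' => /eqP[->].
rewrite (_ : [set w | forall k, fset_count (atom A L k) (glue w) = c k] =
  [set w | counts eta1 (e true) w = [ffun b => c (b, true)]] `*`
  [set w | counts eta2 (e false) w = [ffun b => c (b, false)]]); last first.
  rewrite !countsE; apply/seteqP; split => -[w1 w2] /=.
    move=> h; split => b; rewrite ffunE; first by rewrite -h fset_count_atom_glue.
    by rewrite -h fset_count_atom_glue.
  move=> [h1 h2] [b []]; rewrite fset_count_atom_glue /=.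
    by have := h1 b; rewrite ffunE.
  by have := h2 b; rewrite ffunE.
rewrite [RHS](_ : _ =
    P [set w | counts eta1 (e true) w = [ffun b => c (b, true)]] *
    P [set w | counts eta2 (e false) w = [ffun b => c (b, false)]]); last first.
  apply: product_measure1E; first exact: (measurable_counts heta1 (me true)).
  exact: (measurable_counts heta2 (me false)).
rewrite (counts_law heta1 (me true) (de true)) (counts_law heta2 (me false) (de false)).
rewrite -EFinM; congr EFin.
pose F b z := poisson_mass (fine (Lambda2 (atom A L (b, z)))) (c (b, z)).
rewrite -big_split /= [LHS](eq_bigr (fun k => F k.1 k.2)); last first.
  by case=> b z _; rewrite ffunE.
rewrite -(pair_bigA _ F) /F /=.
apply: eq_bigr => b _; rewrite !ffunE big_bool /= -Lambda12 //.
by move=> x [_ /=] /set_mem.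
Qed.

Lemma integral_glue (Psi : configs R -> \bar R) :
  measurable_fun setT Psi -> (forall V, 0 <= Psi V) ->
  \int[P]_w Psi (eta2 w) = \int[P]_w1 \int[P]_w2 Psi (glue (w1, w2)).
Proof.
move=> mPsi Psi0; rewrite -(fubini_tonelli1 (fun w => Psi (glue w))) //; last first.
  exact: (measurableT_comp mPsi measurable_glue).
apply: (configs_law_eq (P1 := P) (P2 := P \x P)) => //.
- exact: measurable_eta heta2.
- exact: measurable_glue.
move=> I A c mA.
(* The indicator of the cylinder over [A] as a function of atom counts: each probability becomes a
   series over the possible atom counts, and the series are compared termwise. *)
pose f (N : {ffun {ffun I -> bool} * bool -> nat}) : \bar R :=
  ([forall i, (\sum_(k : {ffun I -> bool} * bool | k.1 i) N k)%N == c i])%:R%:E.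
have ma := measurable_atom mA mL.
have evE d' (S : measurableType d') (Q : probability S R) (xi : S -> configs R) :
    measurable_fun setT xi ->
    Q [set w | forall i, fset_count (A i) (xi w) = c i] =
    \esum_(N in setT) (f N * Q [set w | forall k, fset_count (atom A L k) (xi w) = N k]).
  move=> mxi; pose N0 w : {ffun {ffun I -> bool} * bool -> nat} :=
    [ffun k => fset_count (atom A L k) (xi w)].
  have N0E (N : {ffun {ffun I -> bool} * bool -> nat}) :
      [set w | forall k, fset_count (atom A L k) (xi w) = N k] = [set w | N0 w = N].
    apply/seteqP; split => w /=; last by move=> <- k; rewrite ffunE.
    by move=> h; apply/ffunP => k; rewrite ffunE.
  have mfin (K : finType) (B : K -> set RM) (n : K -> nat) :
      (forall k, measurable (B k)) ->
      measurable [set w | forall k, fset_count (B k) (xi w) = n k].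
    move=> mB; pose E := [set V : configs R | forall k, fset_count (B k) V = n k].
    have mE : measurable E by apply: sub_sigma_algebra; exists K, B, n.
    by have := mxi measurableT E mE; rewrite setTI.
  under eq_esum do rewrite N0E.
  rewrite -(@integral_countable_comp _ _ _ Q _ N0 _ f); last 2 first.
  - by move=> N; rewrite -N0E; exact: mfin.
  - by move=> N; rewrite /f lee_fin.
  transitivity (Q ([set w | forall i, fset_count (A i) (xi w) = c i] `&` setT)).
    by rewrite setIT.
  rewrite -integral_indic //; last exact: mfin.
  apply: eq_integral => w _; rewrite indicE /f; congr (_%:R%:E)%R; congr nat_of_bool.
  apply/idP/forallP => [/set_mem /= h i|h].
    rewrite -h (fset_count_atoms A L i (xi w)); apply/eqP; apply: eq_bigr => k _.
    by rewrite ffunE.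
  apply/mem_set => i /=; rewrite -(eqP (h i)) (fset_count_atoms A L i (xi w)).
  by apply: eq_bigr => k _; rewrite ffunE.
rewrite !evE //; [|exact: measurable_glue|exact: measurable_eta heta2].
by apply: eq_esum => N _; rewrite glue_atoms_law.
Qed.
End superposition.

(** * Null sets, reflections and the intensity *)

Section null_modification.
Context d (T : measurableType d) (R : realType) (mu : {measure set T -> \bar R}).
Import HBNNSimple.

(* [f] need not be measurable, its integral is a supremum over simple functions below it. *)
Lemma ge0_integral_eq_off_null (f g : T -> \bar R) (N : set T) :
  measurable N -> mu N = 0 -> measurable_fun setT g ->
  (forall x, 0 <= f x) -> (forall x, 0 <= g x) ->
  (forall x, ~ N x -> f x = g x) -> \int[mu]_x f x = \int[mu]_x g x.
Proof.
move=> mN N0 mg f0 g0 fg; apply/eqP; rewrite eq_le; apply/andP; split.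
  rewrite ge0_integralTE //; apply: ge_ereal_sup => _ [h /= hf <-].
  rewrite -integralT_nnsfun (ge0_negligible_integral mN) //; last 2 first.
  - by apply/measurable_EFinP.
  - by move=> x _; rewrite lee_fin.
  apply: (@le_trans _ _ (\int[mu]_(x in setT `\` N) g x)).
    apply: ge0_le_integral => //.
    - exact: measurableD.
    - by move=> x _; rewrite lee_fin.
    - by apply/measurable_EFinP; exact: measurable_funTS.
    - exact: measurable_funTS.
    - by move=> x [_ Nx]; rewrite -fg.
  by apply: ge0_subset_integral => //; exact: measurableD.
(* Cutting [g] off [N] keeps its integral, and nonnegative simple functions below the cut function
   vanish on [N], hence lie below [f] everywhere. *)
rewrite (ge0_negligible_integral mN) // integral_mkcond.
rewrite [leRHS]ge0_integralTE // ge0_integralTE; last by move=> x; rewrite patchE; case: ifP.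
apply: le_ereal_sup => _ [h /= hg <-]; exists h => // x.
apply: (le_trans (hg x)); rewrite patchE; case: ifPn => // /set_mem [_ Nx].
by rewrite fg.
Qed.

End null_modification.

Section reflection.
Context (R : realType).
Local Notation RM := (measurableTypeR R).
Local Notation mu := (@lebesgue_measure R).

Lemma measurable_reflect (c : R) : measurable_fun [set: RM] ((fun s => c - s)%R : RM -> RM).
Proof. by apply: measurable_funB. Qed.

Lemma ge0_integral_reflect (c : R) (f : R -> \bar R) :
  measurable_fun [set: RM] (f : RM -> \bar R) -> (forall x, 0 <= f x) ->
  \int[mu]_s f (c - s)%R = \int[mu]_x f x.
Proof.
move=> mf f0.
have mr := measurable_reflect c.
rewrite -[LHS](ge0_integral_pushforward mr mu measurableT mf) //.
pose F : {measure set RM -> \bar R} := pushforward mu ((fun s => c - s)%R : RM -> RM).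
rewrite -[LHS]/(\int[F mr]_y f y).
apply: eq_measure_integral => A mA _.
apply/esym/lebesgue_measure_unique => //= _ [[a b]] _ <-.
rewrite /F /pushforward /= (_ : _ @^-1` _ = `[c - b, c - a[%classic)%R; last first.
  by apply/seteqP; split => x /=; rewrite !in_itv /=; lra.
rewrite !lebesgue_measure_itv /= !lte_fin.
rewrite (_ : (c - b < c - a)%R = (a < b)%R); last by apply/idP/idP; lra.
by case: ifP => // _; rewrite -!EFinD; congr EFin; lra.
Qed.

(** Two reflections, [s -> - c - s] and [x -> - x], compose to a translation. *)
Lemma ge0_integral_shift (c : R) (f : R -> \bar R) :
  measurable_fun [set: RM] (f : RM -> \bar R) -> (forall x, 0 <= f x) ->
  \int[mu]_s f (s - c)%R = \int[mu]_x f x.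
Proof.
move=> mf f0; rewrite -[RHS](ge0_integral_reflect (- c)) //.
have mfc : measurable_fun [set: RM] ((fun s => f (- c - s)%R) : RM -> \bar R).
  exact: (measurableT_comp mf (@measurable_reflect (- c))).
rewrite -[RHS](@ge0_integral_reflect 0%R _ mfc) //.
by apply: eq_integral => x _; congr f; lra.
Qed.
End reflection.

Section intensity.
Context (R : realType) (r : R) (hr : (0 < r)%R) (lam : nat -> R -> R).
Hypothesis hlam : forall l : nat, (1 <= l)%N -> cell_density r (lam l).
Local Notation RM := (measurableTypeR R).
Local Notation mu := (@lebesgue_measure R).
Local Notation dens := (intensity_density r lam).

(** The half-open cut matches the cells, so the total density is a plain sum of translates without
    overlap at the multiples of [r]. *)
Let lamc l : R -> R := lam l \_ `]0%R, r].

Let lamc_ge0 l y : (1 <= l)%N -> (0 <= lamc l y)%R.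
Proof.
move=> l1; rewrite /lamc patchE; case: ifPn => // /set_mem.
rewrite /= in_itv /= => /andP[y0 yr]; have [h _] := hlam l1.
by apply: h; rewrite (ltW y0).
Qed.

Let ilamc l : (1 <= l)%N -> mu.-integrable setT (EFin \o lamc l).
Proof.
move=> l1; have [_ h] := hlam l1.
have : mu.-integrable `]0%R, r] (EFin \o lam l).
  apply: integrableS h => //; apply: subset_itvr; by rewrite bnd_simp.
by move/integrable_mkcond => /(_ (measurable_itv _)); rewrite restrict_EFin.
Qed.

Let mlamc l : (1 <= l)%N -> measurable_fun [set: RM] (lamc l : RM -> R).
Proof. by move=> /ilamc/measurable_int/measurable_EFinP. Qed.

Let densE k x : dens k x = (\sum_(1 <= l < k.+1) lamc l (x - l.-1%:R * r))%R.
Proof.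
rewrite /intensity_density; apply: eq_big_nat => l /andP[l1 _].
rewrite indicE /lamc patchE.
have -> : (x \in `](l.-1%:R * r)%R, (l%:R * r)%R]%classic) =
    (x - l.-1%:R * r \in `]0, r]%classic)%R.
  rewrite !mem_setE !in_itv /= -[in l%:R](prednK l1) -natr1 mulrDl mul1r.
  by congr (_ && _); apply/idP/idP; lra.
by case: ifP => _; rewrite ?mul1r ?mul0r.
Qed.

Let mshift (c : R) (f : RM -> R) : measurable_fun setT f ->
  measurable_fun [set: RM] ((fun x => f (x - c)%R) : RM -> R).
Proof. by move=> mf; apply: measurableT_comp mf _; apply: measurable_funB. Qed.

Lemma intensity_density_ge0 k x : (0 <= dens k x)%R.
Proof.
by rewrite densE big_nat; apply: sumr_ge0 => l /andP[l1 _]; exact: lamc_ge0.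
Qed.

Lemma integrable_intensity_density k : mu.-integrable setT (EFin \o dens k).
Proof.
rewrite (_ : _ \o _ = fun x => \sum_(1 <= l < k.+1 | (1 <= l)%N)
    (lamc l (x - l.-1%:R * r))%:E); last first.
  apply/funext => x; rewrite /= densE -sumEFin big_nat [RHS]big_nat_cond.
  by apply: eq_bigl => -[|l] /=; rewrite ?andbT.
apply: integrable_sum => // l l1.
have ml : measurable_fun [set: RM] ((EFin \o lamc l) : RM -> \bar R).
  by apply/measurable_EFinP; exact: mlamc.
apply/integrableP; split.
  by apply/measurable_EFinP; apply: mshift; exact: mlamc.
have /integrableP[_] := ilamc l1.
rewrite -(@ge0_integral_shift R (l.-1%:R * r) (fun x => `|(EFin \o lamc l) x|)) //.
exact: measurableT_comp.
Qed.

Let lamc_out l y : (y <= 0)%R \/ (r < y)%R -> lamc l y = 0%R.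
Proof.
move=> h; rewrite /lamc patchE; case: ifPn => // /set_mem.
by rewrite /= in_itv /= => /andP[y0 yr]; case: h; lra.
Qed.

Lemma intensity_density_low k x : (x <= k%:R * r)%R -> dens k.+1 x = dens k x.
Proof.
move=> xk; rewrite !densE big_nat_recr //= lamc_out ?addr0 //; left.
by rewrite subr_le0.
Qed.

Lemma intensity_density_cell k x : (1 <= k)%N ->
  (k.-1%:R * r < x <= k%:R * r)%R ->
  dens k.+1 x = lam k (x - k.-1%:R * r)%R.
Proof.
case: k => // k _ /= /andP[kx xk]; rewrite intensity_density_low //.
rewrite densE big_nat_recr //= big_nat big1 ?add0r => [|l /andP[l1 lk]].
  rewrite /lamc patchE mem_set //= in_itv /=.
  by move: xk; rewrite -natr1 mulrDl mul1r; lra.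
apply: lamc_out; right; have : (l.-1.+1%:R * r <= k%:R * r)%R.
  by rewrite ler_wpM2r ?(ltW hr) // ler_nat prednK.
by rewrite -natr1 mulrDl mul1r; lra.
Qed.

Definition grid : set R := [set x | exists j : nat, x = (j%:R * r)%R].

Lemma measurable_grid : measurable (grid : set RM).
Proof.
rewrite (_ : grid = \bigcup_(j : nat) [set (j%:R * r)%R]).
  by apply: bigcup_measurable => j _; exact: measurable_set1.
by apply/seteqP; split => x /= [j]; [move=> ->; exists j | move=> _ ->; exists j].
Qed.

Lemma intensity_grid k : intensity r lam k grid = 0.
Proof.
have mg := measurable_grid.
rewrite /intensity null_set_integral //.
  by apply: measurable_funTS; exact: measurable_int (integrable_intensity_density k).
apply: countable_lebesgue_measure0.
rewrite (_ : grid = (fun j : nat => j%:R * r)%R @` setT); last first.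
  by apply/seteqP; split => x /= [j]; [move=> ->; exists j | move=> _ <-; exists j].
exact: (sub_countable (card_image_le _ _)).
Qed.

End intensity.

(** * Integrating a joint cumulant one variable at a time *)

Section dominated.
Context (R : realType) d (Omega : measurableType d) (P : probability Omega R).
Context (N : Omega -> R).
Hypothesis N_ge0 : forall w, (0 <= N w)%R.
Hypothesis N_moments : forall p : nat, \int[P]_w ((1 + N w) ^+ p)%:E < +oo.
Hypothesis mN : measurable_fun setT N.
Local Notation RM := (measurableTypeR R).
Local Notation mu := (@lebesgue_measure R).

Definition bound_by (C : R) (p : nat) (w : Omega) : R := (C * (1 + N w) ^+ p)%R.

(** Polynomial growth in [N], the number of nodes in the application. The class is stable under
    products and under integrating out a parameter, and its members have finite integral. *)
Definition dominated (X : Omega -> R) := measurable_fun setT X /\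
  exists C p, (0 <= C)%R /\ forall w, (0 <= X w <= bound_by C p w)%R.

Let N1 w : (1 <= 1 + N w)%R.
Proof. by rewrite lerDl. Qed.

Lemma dominated_cst c : (0 <= c)%R -> dominated (fun=> c).
Proof.
by move=> c0; split => //; exists c, 0%N; split => // w; rewrite /bound_by c0 expr0 mulr1 lexx.
Qed.

Lemma dominatedM X Y : dominated X -> dominated Y -> dominated (X \* Y)%R.
Proof.
move=> [mX [C [p [C0 XC]]]] [mY [E [q [E0 YE]]]]; split.
  exact: measurable_funM.
exists (C * E)%R, (p + q)%N; split; first exact: mulr_ge0.
move=> w; have /andP[X0 Xw] := XC w; have /andP[Y0 Yw] := YE w.
by rewrite mulr_ge0 //= /bound_by exprD mulrACA ler_pM.
Qed.

Lemma dominated_prod (I : finType) (A : {pred I}) (X : I -> Omega -> R) :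
  (forall i, i \in A -> dominated (X i)) ->
  dominated (fun w => \prod_(i in A) X i w)%R.
Proof.
move=> dX.
have -> : (fun w => \prod_(i in A) X i w)%R = (\prod_(i in A) X i)%R.
  apply/funext => w.
  by rewrite (big_morph (fun f : Omega -> R => f w) (id1 := 1%R) (op1 := *%R)).
apply: (big_ind dominated) => [|Y Z|i iA]; [exact: dominated_cst | exact: dominatedM | exact: dX].
Qed.

Lemma dominated_fin X : dominated X -> \int[P]_w (X w)%:E \is a fin_num.
Proof.
move=> [mX [C [p [C0 XC]]]].
have X0 w : (0 <= X w)%R by case/andP: (XC w).
rewrite ge0_fin_numE; last by apply: integral_ge0 => w _; rewrite lee_fin.
apply: (@le_lt_trans _ _ (\int[P]_w (C%:E * ((1 + N w) ^+ p)%:E))).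
  apply: ge0_le_integral => //.
  - by move=> w _; rewrite lee_fin.
  - exact/measurable_EFinP.
  - apply: emeasurable_funM => //; apply/measurable_EFinP.
    by apply: measurable_funX; exact: measurable_funD.
  - by move=> w _; rewrite -EFinM lee_fin; case/andP: (XC w).
rewrite ge0_integralZl_EFin //.
- by rewrite lte_mul_pinfty // ?lee_fin //.
- by move=> w _; rewrite lee_fin exprn_ge0 // addr_ge0.
- by apply/measurable_EFinP; apply: measurable_funX; exact: measurable_funD.
Qed.

Section one_variable.
Context (G : R -> R) (G_ge0 : forall s, (0 <= G s)%R).
Hypothesis iG : mu.-integrable setT (EFin \o G).
Context (y : R -> Omega -> R).
Hypothesis my : measurable_fun setT (fun u : RM * Omega => y u.1 u.2).
Context (C : R) (p : nat) (C0 : (0 <= C)%R).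
Hypothesis yC : forall s w, (0 <= y s w <= bound_by C p w)%R.

Lemma dominated_section s : dominated (y s).
Proof.
split; last by exists C, p.
exact: (measurableT_comp my (@pair1_measurable _ _ RM Omega s)).
Qed.

Definition integral_out (w : Omega) : R := \int[mu]_s (y s w * G s).

Let mG : measurable_fun [set: RM] (G : RM -> R).
Proof. by apply/measurable_EFinP; exact: measurable_int iG. Qed.

Let mass : R := fine (\int[mu]_s (G s)%:E).

Let massE : \int[mu]_s (G s)%:E = mass%:E.
Proof. by rewrite /mass fineK //; exact: integrable_fin_num. Qed.

Let my1 w : measurable_fun [set: RM] ((fun s => y s w) : RM -> R).
Proof. exact: (@measurable_fun_pair1 _ _ _ RM Omega R (fun u => y u.1 u.2) w my). Qed.

Let y0 s w : (0 <= y s w)%R.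
Proof. by case/andP: (yC s w). Qed.

Let bound_ge0 w : (0 <= bound_by C p w)%R.
Proof. by case/andP: (yC 0%R w) => /le_trans; apply. Qed.

Let myG w : measurable_fun [set: RM] ((fun s => (y s w * G s)%:E) : RM -> \bar R).
Proof. by apply/measurable_EFinP; exact: measurable_funM. Qed.

Let integral_out_le w : \int[mu]_s (y s w * G s)%:E <= (bound_by C p w * mass)%:E.
Proof.
rewrite EFinM -massE -ge0_integralZl_EFin //; last 2 first.
- by move=> s _; rewrite lee_fin.
- exact/measurable_EFinP.
apply: ge0_le_integral => //.
- by move=> s _; rewrite lee_fin mulr_ge0.
- by apply: emeasurable_funM => //; exact/measurable_EFinP.
- by move=> s _; rewrite -EFinM lee_fin ler_wpM2r //; case/andP: (yC s w).
Qed.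

Let integral_outE w : \int[mu]_s (y s w * G s)%:E = (integral_out w)%:E.
Proof.
rewrite /integral_out /Rintegral fineK // ge0_fin_numE.
  exact: le_lt_trans (integral_out_le w) (ltry _).
by apply: integral_ge0 => s _; rewrite lee_fin mulr_ge0.
Qed.

Let integral_out_ge0 w : (0 <= integral_out w)%R.
Proof. by apply: Rintegral_ge0 => s _; rewrite mulr_ge0. Qed.

Let mGfst : measurable_fun setT (fun u : RM * Omega => G u.1).
Proof. exact: (measurableT_comp mG measurable_fst). Qed.

Lemma dominated_integral_out : dominated integral_out.
Proof.
split.
  apply: measurableT_comp => //.
  apply: (@measurable_fun_fubini_tonelli_G _ _ _ _ _ mu
    (fun u : RM * Omega => (y u.1 u.2 * G u.1)%:E)).
    by apply/measurable_EFinP; exact: measurable_funM.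
  by move=> u; rewrite lee_fin mulr_ge0.
have mass0 : (0 <= mass)%R by apply: fine_ge0; apply: integral_ge0 => s _; rewrite lee_fin.
exists (C * mass)%R, p; split; first exact: mulr_ge0.
move=> w; rewrite integral_out_ge0 /= -lee_fin -integral_outE.
by apply: le_trans (integral_out_le w) _; rewrite lee_fin /bound_by mulrAC.
Qed.

(** Tonelli's theorem, where [W] stands for the other factors of a mixed moment. Domination keeps
    the inner integrals finite, so [fine] loses nothing. *)
Lemma integral_expectation W : dominated W ->
  \int[mu]_s (fine (\int[P]_w (y s w * W w)%:E) * G s)%:E =
  \int[P]_w (integral_out w * W w)%:E.
Proof.
move=> dW; have [mW [CW [q [CW0 WC]]]] := dW.
have W0 w : (0 <= W w)%R by case/andP: (WC w).
have mh : measurable_fun setT (fun u : RM * Omega => (y u.1 u.2 * W u.2 * G u.1)%:E).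
  apply/measurable_EFinP; apply: measurable_funM => //; apply: measurable_funM => //.
  exact: (measurableT_comp mW measurable_snd).
transitivity (\int[mu]_s \int[P]_w (y s w * W w * G s)%:E).
  apply: eq_integral => s _; rewrite EFinM fineK; last first.
    by apply: dominated_fin; apply: dominatedM => //; exact: dominated_section.
  rewrite muleC -ge0_integralZl_EFin //; last 2 first.
  - by move=> w _; rewrite lee_fin mulr_ge0.
  - apply/measurable_EFinP; apply: measurable_funM => //.
    by have [] := dominated_section s.
  by apply: eq_integral => w _; rewrite -EFinM mulrC.
rewrite (@fubini_tonelli _ _ _ _ _ mu P
  (fun u : RM * Omega => (y u.1 u.2 * W u.2 * G u.1)%:E)) //; last first.
  by move=> u; rewrite lee_fin !mulr_ge0.
apply: eq_integral => w _; rewrite EFinM -integral_outE muleC.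
rewrite -ge0_integralZl_EFin //.
  by apply: eq_integral => s _; rewrite -EFinM /= mulrCA mulrA.
by move=> s _; rewrite lee_fin mulr_ge0.
Qed.

Lemma integrable_expectation W : dominated W ->
  mu.-integrable setT (fun s => (fine (\int[P]_w (y s w * W w)%:E) * G s)%:E).
Proof.
move=> dW; have [mW [CW [q [CW0 WC]]]] := dW.
have W0 w : (0 <= W w)%R by case/andP: (WC w).
have f0 s : (0 <= fine (\int[P]_w (y s w * W w)%:E) * G s)%R.
  by rewrite mulr_ge0 // fine_ge0 // integral_ge0 // => w _; rewrite lee_fin mulr_ge0.
apply/integrableP; split.
  apply/measurable_EFinP; apply: measurable_funM => //.
  apply: measurableT_comp => //.
  apply: (@measurable_fun_fubini_tonelli_F _ _ _ _ _ P
    (fun u : RM * Omega => (y u.1 u.2 * W u.2)%:E)).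
    apply/measurable_EFinP; apply: measurable_funM => //.
    exact: (measurableT_comp mW measurable_snd).
  by move=> u; rewrite lee_fin mulr_ge0.
under eq_integral do rewrite /= ger0_norm //.
rewrite integral_expectation // ltey_eq dominated_fin //.
by apply: dominatedM => //; exact: dominated_integral_out.
Qed.

End one_variable.
End dominated.

Local Close Scope ereal_scope.

Section peeling.
Context (R : realType) d (Omega : measurableType d) (P : probability Omega R).
Context (N : Omega -> R).
Hypothesis N_ge0 : forall w, (0 <= N w)%R.
Hypothesis N_moments : forall p : nat, (\int[P]_w ((1 + N w) ^+ p)%:E < +oo)%E.
Hypothesis mN : measurable_fun setT N.
Local Notation RM := (measurableTypeR R).
Local Notation mu := (@lebesgue_measure R).
Local Notation dominated := (dominated N).

Context (r : R) (g : R -> R).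
Hypothesis g_ge0 : forall s, 0 <= s <= r -> 0 <= g s.
Hypothesis ig : mu.-integrable `[0, r] (EFin \o g).

Definition weighted_integral (y : R -> Omega -> R) (u : R) (w : Omega) : R :=
  \int[mu]_(s in `[0, u]) (y s w * g s).

Definition bounded_kernel (y : R -> Omega -> R) :=
  measurable_fun setT (fun u : RM * Omega => y u.1 u.2) /\
  exists C p, (0 <= C)%R /\ forall s w, (0 <= y s w <= bound_by N C p w)%R.

Section cut.
Context (u : R) (ur : u <= r).
Let G : R -> R := g \_ `[0, u].

Let G_ge0 s : 0 <= G s.
Proof.
rewrite /G patchE; case: ifPn => // /set_mem; rewrite /= in_itv /= => /andP[s0 su].
by apply: g_ge0; rewrite s0 (le_trans su).
Qed.

Let iG : mu.-integrable setT (EFin \o G).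
Proof.
have : mu.-integrable `[0, u] (EFin \o g).
  by apply: integrableS ig => //; apply: subset_itvl; rewrite bnd_simp.
by move/integrable_mkcond => /(_ (measurable_itv _)); rewrite restrict_EFin.
Qed.

Let Rintegral_cut (h : R -> R) :
  \int[mu]_(s in `[0, u]) (h s * g s) = \int[mu]_s (h s * G s).
Proof.
rewrite Rintegral_mkcond; apply: eq_Rintegral => s _.
by rewrite /G !patchE; case: ifP; rewrite ?mulr0.
Qed.

Lemma weighted_integral_out y w : weighted_integral y u w = integral_out G y w.
Proof. exact: Rintegral_cut. Qed.

Lemma dominated_weighted_integral y : bounded_kernel y ->
  dominated (weighted_integral y u).
Proof.
move=> [my [C [p [C0 yC]]]].
have -> : weighted_integral y u = integral_out G y.
  by apply/funext => w; exact: weighted_integral_out.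
exact: (@dominated_integral_out _ _ _ N G G_ge0 iG y my C p C0 yC).
Qed.

(** In each partition exactly one block contains [a], so each term of the cumulant is linear in the
    argument at [a]: [W pi] gathers the other factors of that block, [K pi] all that does not
    involve [a]. *)
Lemma Rintegral_joint_cumulant n (a : 'I_n) (V : 'I_n -> Omega -> R) y :
  bounded_kernel y -> (forall i, dominated (V i)) ->
  \int[mu]_(s in `[0, u])
     (joint_cumulant P (fun i => if i == a then y s else V i) * g s) =
  joint_cumulant P (fun i => if i == a then weighted_integral y u else V i).
Proof.
move=> [my [C [p [C0 yC]]]] dV.
have n0 : (0 < n)%N by apply: leq_ltn_trans (ltn_ord a).
rewrite Rintegral_cut joint_cumulantE //.
pose W (pi : {set {set 'I_n}}) w := \prod_(i in (finset.pblock pi a :\ a)%SET) V i w.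
pose K (pi : {set {set 'I_n}}) : R := cumulant_coef R #|pi| *
  \prod_(B in (pi :\ finset.pblock pi a)%SET) mixed_moment P V B.
have dW pi : dominated (W pi) by apply: dominated_prod.
have blockE (z : Omega -> R) pi : setpart pi [set: 'I_n]%SET ->
   cumulant_coef R #|pi| * \prod_(B in pi)
      mixed_moment P (fun i => if i == a then z else V i) B =
   K pi * fine (\int[P]_w (z w * W pi w)%:E).
  move=> piP; set B0 := finset.pblock pi a.
  have api : a \in finset.cover pi by rewrite (cover_partition piP) finset.in_setT.
  have B0pi : B0 \in pi by rewrite /B0 pblock_mem.
  have aB0 : a \in B0 by rewrite /B0 finset.mem_pblock.
  rewrite (big_setD1 B0) //= /K -/B0 mulrCA [RHS]mulrC; congr (_ * _).
    rewrite /mixed_moment unlock; congr fine; apply: eq_integral => w _.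
    congr EFin; rewrite (big_setD1 a) //= eqxx; congr (_ * _).
    by apply: eq_bigr => i; rewrite !inE => /andP[/negPf ->].
  congr (_ * _); apply: eq_bigr => B; rewrite !inE => /andP[BB0 Bpi].
  congr fine; congr expectation; apply/funext => w; apply: eq_bigr => i iB.
  case: eqP => // ia; case/eqP: BB0; rewrite /B0 -ia.
  by apply/esym/(def_pblock (partition_trivIset piP) Bpi).
rewrite [RHS](eq_bigr _ (fun pi piP => blockE _ pi piP)).
rewrite /Rintegral.
transitivity (fine (\int[mu]_s \sum_(pi | setpart pi [set: 'I_n]%SET)
   ((K pi)%:E * (fine (\int[P]_w (y s w * W pi w)%:E) * G s)%:E)))%E.
  congr fine; apply: eq_integral => s _.
  rewrite joint_cumulantE // (eq_bigr _ (fun pi piP => blockE _ pi piP)).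
  by rewrite mulr_suml -sumEFin; apply: eq_bigr => pi _; rewrite -EFinM mulrA.
have iE pi := @integrable_expectation _ _ _ P N N_ge0 N_moments mN G G_ge0 iG
  y my C p C0 yC _ (dW pi).
rewrite integral_sum //; last by move=> pi; apply: integrableZl.
rewrite -[RHS]/(fine (_ %:E)) -sumEFin; congr fine; apply: eq_bigr => pi _.
rewrite integralZl // [RHS]EFinM; congr (_ * _)%E.
rewrite (@integral_expectation _ _ _ P N N_ge0 N_moments mN G G_ge0 iG
  y my C p C0 yC _ (dW pi)).
under [in RHS]eq_integral do rewrite weighted_integral_out.
rewrite fineK //; apply: (dominated_fin N_ge0 N_moments mN); apply: dominatedM => //.
exact: (@dominated_integral_out _ _ _ N G G_ge0 iG y my C p C0 yC).
Qed.

End cut.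
(* The first [a] arguments are those already integrated or frozen. *)
Lemma iterated_joint_cumulant n (y : nat -> R -> Omega -> R) (us : seq R) :
  (forall j, bounded_kernel (y j)) -> (forall u, u \in us -> u <= r) ->
  forall a (W : nat -> Omega -> R), (a + size us = n)%N ->
  (forall j, dominated (W j)) ->
  iterated_integral g us (fun ss => joint_cumulant P (fun j : 'I_n =>
     if (j < a)%N then W j else y j ss`_(j - a))) =
  joint_cumulant P (fun j : 'I_n =>
     if (j < a)%N then W j else weighted_integral (y j) us`_(j - a)).
Proof.
move=> yB; elim: us => [|u us IH] usr a W aus dW /=.
  congr joint_cumulant; apply/funext => j; rewrite addn0 in aus.
  by rewrite aus ltn_ord.
have an : (a < n)%N by rewrite -aus /= addnS ltnS leq_addr.
have ur : u <= r by apply: usr; rewrite inE eqxx.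
have usr' : forall v, v \in us -> v <= r by move=> v vus; apply: usr; rewrite inE vus orbT.
pose V (j : 'I_n) := if (j < a)%N then W j else weighted_integral (y j) (u :: us)`_(j - a).
have dV j : dominated (V j).
  rewrite /V; case: ifP => // _; apply: dominated_weighted_integral => //.
  have [jus|jus] := ltnP (j - a) (size (u :: us)); first by apply/usr/mem_nth.
  have aus' : (a + (size us).+1 = n)%N := aus; rewrite /= in jus.
  by have := ltn_ord j; lia.
have -> : (fun j : 'I_n => if (j < a)%N then W j
    else weighted_integral (y j) (u :: us)`_(j - a)) =
  (fun j => if j == Ordinal an then weighted_integral (y a) u else V j).
  apply/funext => j; case: eqP => [->|ja] //=.
  by rewrite ltnn subnn.
(* Read from right to left: the integral at [a] is opened while the later arguments stay integrated.
   With argument [a] frozen at [s] in [Ws], the induction hypothesis treats the latter under the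
   integral. *)
rewrite -Rintegral_joint_cumulant //; apply: eq_Rintegral => s _; congr (_ * _).
pose Ws (j : nat) := if j == a then y a s else W j.
have dWs j : dominated (Ws j).
  rewrite /Ws; case: ifP => // _; have [my [C [p [C0 yC]]]] := yB a.
  exact: (@dominated_section _ _ _ N (y a) my C p C0 yC).
have := IH usr' a.+1 Ws _ dWs; rewrite addSnnS => /(_ aus).
have jE (j : 'I_n) (ss : seq R) b : j != Ordinal an -> (j < a)%N = false ->
    (b :: ss)`_(j - a) = ss`_(j - a.+1).
  move=> ja jlt; have : (a < j)%N.
    by rewrite ltn_neqAle eq_sym (ja : (j : nat) != a) /= leqNgt jlt.
  by move=> aj; rewrite subnS; case: (j - a)%N (subn_gt0 a j) => // ; rewrite aj.
move=> E; transitivity (iterated_integral g us (fun ss => joint_cumulant P (fun j : 'I_n =>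
    if (j < a.+1)%N then Ws j else y j ss`_(j - a.+1)))).
  congr iterated_integral; apply/funext => ss; congr joint_cumulant; apply/funext => j.
  rewrite /Ws [in RHS]ltnS [in RHS]leq_eqVlt; case: (eqVneq j (Ordinal an)) => [->|ja].
    by rewrite /= eqxx ltnn subnn.
  rewrite (negPf (ja : (j : nat) != a)) /=; case: ifP => // jlt.
  by rewrite jE.
rewrite E; congr joint_cumulant; apply/funext => j.
rewrite /Ws /V [in LHS]ltnS [in LHS]leq_eqVlt; case: (eqVneq j (Ordinal an)) => [->|ja].
  by rewrite /= eqxx.
rewrite (negPf (ja : (j : nat) != a)) /=; case: ifP => // jlt.
by rewrite jE.
Qed.

End peeling.

(** * Recursion for the moments and the cumulants *)

Section nat_valued.
Context d (S : measurableType d) (R : realType).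

Lemma measurable_natr (h : S -> nat) :
  measurable_fun setT (fun s => (h s)%:R%:E : \bar R) -> measurable_fun setT h.
Proof.
move=> mh _ B _; rewrite setTI.
rewrite (_ : h @^-1` B =
  \bigcup_(n in B) ((fun s => (h s)%:R%:E : \bar R) @^-1` [set n%:R%:E])).
  apply: bigcup_measurable => n _.
  by have := mh measurableT _ (emeasurable_set1 n%:R%:E); rewrite setTI.
apply/seteqP; split => s /=; first by move=> Bs; exists (h s).
by move=> [n Bn] /= [] /eqP; rewrite eqr_nat => /eqP ->.
Qed.
End nat_valued.

Section count_moments.
Context (R : realType) d (Omega : measurableType d) (P : probability Omega R).
Context (D : set R) (dens : R -> R) (eta : Omega -> {fset R}).
Local Notation RM := (measurableTypeR R).
Local Notation mu := (@lebesgue_measure R).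
Hypothesis dens0 : forall x, 0 <= dens x.
Hypothesis idens : mu.-integrable setT (EFin \o dens).
Hypothesis heta : poisson_process P D
  (fun A => \int[mu]_(x in A) (dens x)%:E)%E eta.

Lemma measurable_card_nodes : measurable_fun setT (fun w => #|` eta w|%:R : R).
Proof.
apply: (@measurable_nat_comp _ _ _ _ (fun n => n%:R : R) (fun w => #|` eta w|)).
under eq_fun do rewrite -fset_countT.
exact: (measurableT_comp (measurable_fset_count measurableT) (measurable_eta heta)).
Qed.

Lemma card_nodes_moments p :
  (\int[P]_w ((1 + #|` eta w|%:R) ^+ p)%:E < +oo)%E.
Proof.
have mN := measurable_card_nodes.
have mNp (q : nat) : measurable_fun setT (fun w => ((#|` eta w|%:R : R) ^+ q)%:E).
  by apply/measurable_EFinP; exact: measurable_funX.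
have := @poisson_moments _ _ _ P D dens eta dens0 idens heta 'I_p (fun _ _ => 1%N) 1
  (fun _ => measurable_cst _) (fun _ _ => leqnn 1) [set: 'I_p]%SET.
set m := (\sum_(_ | _) _) => mE.
(* [1 + q <= 2 q] for [q >= 1], and the summand 1 covers [q = 0]. The p-th moment itself is the
   moment formula with all functions equal to 1. *)
apply: (@le_lt_trans _ _ (\int[P]_w (1%:E + (2 ^+ p)%:E * (#|` eta w|%:R ^+ p)%:E))%E).
  apply: ge0_le_integral => //.
  - apply/measurable_EFinP; apply: measurable_funX; exact: measurable_funD.
  - by apply: emeasurable_funD => //; apply: emeasurable_funM.
  - move=> w _; rewrite -EFinM -EFinD lee_fin -exprMn.
    case: (#|` eta w|) => [|q].
      by rewrite addr0 expr1n lerDl exprn_ge0 // mulr0.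
    apply: (@le_trans _ _ ((2 * q.+1%:R) ^+ p)); last by rewrite lerDr.
    apply: lerXn2r; rewrite ?nnegrE ?addr_ge0 ?mulr_ge0 //.
    by rewrite -natr1; have := ler0n R q; lra.
rewrite ge0_integralD //; last by apply: emeasurable_funM.
rewrite ge0_integralZl_EFin //.
rewrite integral_cst // [X in (_ + _ * X)%E](_ : _ = m%:E).
  by rewrite -[X in (_ * X + _)%E]/(P setT) probability_setT mule1 -EFinM -EFinD ltry.
rewrite -mE; apply: eq_integral => w _; congr EFin.
rewrite (eq_bigr (fun=> #|` eta w|%:R)).
  by rewrite prodr_const finset.cardsT card_ord.
by move=> i _; rewrite /fset_total card_fset_sum1.
Qed.
End count_moments.

(** * Paths through the last visited cell *)

Section last_cell.
Context (R : realType) (r : R) (hr : 0 < r) (lam : nat -> R -> R).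
Hypothesis hlam : forall l : nat, (1 <= l)%N -> cell_density r (lam l).
Context (k n : nat) (tau : 'I_n -> R).
Hypothesis htau : forall i, 0 <= tau i <= r.
Local Notation RM := (measurableTypeR R).
Local Notation mu := (@lebesgue_measure R).
Local Notation dens := (intensity_density r lam k.+2).
(** The index is shifted by one against the theorem: [walks r k] counts [k.+1]-hops, and the last
    intermediate node of a [k.+2]-hop lies in []c, K]], the cell number [k.+1]. *)
Let c : R := k%:R * r.
Let K : R := k.+1%:R * r.
Let g (s : R) : R := lam k.+1 (r - s).
Let t (i : 'I_n) : R := k.+2%:R * r - tau i.

Let KE : K = c + r.
Proof. by rewrite /K -natr1 mulrDl mul1r. Qed.

Let tE i : t i = K + r - tau i.
Proof. by rewrite /t -natr1 mulrDl mul1r. Qed.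

Lemma last_density_ge0 s : 0 <= s <= r -> 0 <= g s.
Proof.
move=> /andP[s0 sr]; have [h _] := @hlam k.+1 isT; apply: h.
by rewrite subr_ge0 sr /= lerBlDr lerDl.
Qed.

Lemma integrable_last_density : mu.-integrable `[0, r] (EFin \o g).
Proof.
have [_ il] := @hlam k.+1 isT.
have i1 : mu.-integrable setT (EFin \o (lam k.+1 \_ `[0, r])).
  by move/integrable_mkcond: il => /(_ (measurable_itv _)); rewrite restrict_EFin.
have m1 : measurable_fun [set: RM] ((lam k.+1 \_ `[0, r]) : RM -> R).
  by apply/measurable_EFinP; exact: measurable_int i1.
apply/integrable_mkcond => //; rewrite restrict_EFin.
have -> : g \_ `[0, r] = (fun s => (lam k.+1 \_ `[0, r]) (r - s)).
  apply/funext => s; rewrite !patchE; congr (if _ then _ else _).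
  by rewrite !mem_setE !in_itv /=; apply/idP/idP; lra.
apply/integrableP; split.
  by apply/measurable_EFinP; apply: measurableT_comp m1 _; exact: measurable_reflect.
have /integrableP[_] := i1.
pose l0 := lam k.+1 \_ `[0, r].
rewrite -(@ge0_integral_reflect R r (fun x => `|(l0 x)%:E|%E)) //.
by apply: measurableT_comp => //; apply/measurable_EFinP.
Qed.

(* Number of walks to the endpoint [t i] whose last node is [x], in the last cell. *)
Definition last_hop (V : {fset R}) (i : 'I_n) (x : R) : nat :=
  if (c < x) && linked r x (t i) then walks r k V x else 0%N.

(* The variable Z_B of the header, for the configuration [V]. *)
Definition last_weight (V : {fset R}) (B : {set 'I_n}) : R :=
  \int[mu]_(s in `[0, block_min r tau B]) ((walks r k V (K - s))%:R ^+ #|B| * g s).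

Let measurable_walks_nat (V : {fset R}) : measurable_fun [set: RM] (walks r k V : RM -> nat).
Proof.
apply: (@measurable_natr _ _ R).
exact: (@measurable_fun_pair2 _ _ _ (configs R) RM _ _ (V : configs R)
  (measurable_walks r k)).
Qed.

Lemma measurable_last_hop V i : measurable_fun [set: RM] (last_hop V i : RM -> nat).
Proof.
apply: measurable_fun_ifT => //; apply: measurable_and.
  by apply: measurable_fun_ltr.
by apply: measurable_linked.
Qed.

Lemma last_hop_le V i x : (last_hop V i x <= #|` V| ^ k)%N.
Proof. by rewrite /last_hop; case: ifP => // _; exact: walks_le. Qed.

Lemma weight_last_hop V B : B != finset.set0 ->
  weight dens (last_hop V) B = last_weight V B.
Proof.
move=> B0; rewrite /weight /last_weight /Rintegral.
set u := block_min r tau B.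
have ur : u <= r by exact: bigmin_le_id.
have ub i : i \in B -> u <= tau i by move=> iB; exact: bigmin_le_cond.
have mdens : measurable_fun [set: RM] (dens : RM -> R).
  by apply/measurable_EFinP; exact: measurable_int (integrable_intensity_density hlam k.+2).
pose h (x : R) : \bar R := ((\prod_(i in B) (last_hop V i x)%:R) * dens x)%:E.
have mh : measurable_fun [set: RM] (h : RM -> \bar R).
  apply/measurable_EFinP; apply: measurable_funM => //.
  under eq_fun do rewrite -big_filter.
  apply: measurable_prod => i _.
  exact: (measurable_nat_comp (fun m => m%:R : R) (measurable_last_hop V i)).
have h0 x : (0 <= h x)%E.
  by rewrite lee_fin mulr_ge0 ?prodr_ge0 // intensity_density_ge0.
congr fine; rewrite -[LHS](ge0_integral_reflect K mh h0).
(* The point [s = r] is the position [x = c], where [last_hop] is 0 while [walks] may not be; it is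
   removed as a null set. *)
have mF : measurable_fun (`[0, u] `\ r : set RM)
    ((fun s => ((walks r k V (K - s))%:R ^+ #|B| * g s)%:E) : RM -> \bar R).
  apply/measurable_EFinP; apply: measurable_funM.
    apply: measurable_funTS; apply: measurable_funX.
    apply: (measurable_nat_comp (fun m => m%:R : R)).
    exact: (measurableT_comp (measurable_walks_nat V) (measurable_reflect K)).
  have mg : measurable_fun (`[0, r] : set RM) (g : RM -> R).
    by apply/measurable_EFinP; exact: measurable_int integrable_last_density.
  apply: measurable_funS mg => // s [/=]; rewrite !in_itv /= => /andP[-> su] _.
  exact: le_trans su ur.
rewrite -[RHS](integral_setD1 _ mF) //; last exact: measurableD.
rewrite [RHS]integral_mkcond; apply: eq_integral => s _; rewrite patchE.
case: ifPn => [/set_mem [/=]|].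
  rewrite in_itv /= => /andP[s0 su] sr.
  have sltr : s < r by rewrite lt_neqAle (le_trans su ur) andbT; apply/eqP.
  have cx : c < K - s by rewrite KE; lra.
  rewrite /h; have -> : dens (K - s) = g s.
    rewrite intensity_density_cell //=.
      by rewrite -/c KE /g; congr lam; lra.
    by rewrite -/c -/K cx /=; lra.
  congr ((_ * _)%:E); rewrite -prodr_const; apply: eq_bigr => i iB.
  rewrite /last_hop cx /= /linked ger0_norm tE; last by have := htau i; lra.
  by have := ub i iB; case: ifP => //; lra.
rewrite notin_setE /= => out.
have /set0Pn[i0 i0B] := B0.
(* A factor vanishes in three ways: [K - s] is beyond [K] and unreachable in [k.+1] hops, it is not
   above [c], or it is too far from an endpoint with [tau i < s]. *)
suff [i iB fi] : exists2 i, i \in B & last_hop V i (K - s) = 0%N.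
  by rewrite /h (bigD1 i) //= fi !mul0r.
have [s0|s0] := ltP s 0.
  exists i0 => //; rewrite /last_hop walks_eq0; first by case: ifP.
  by rewrite -/K; lra.
have [rs|sr] := leP r s.
  by exists i0 => //; rewrite /last_hop ltNge (_ : K - s <= c) // KE; lra.
have su : u < s.
  rewrite ltNge; apply/negP => su; apply: out; split; first by rewrite in_itv /= s0 su.
  by move=> /= sr'; rewrite sr' ltxx in sr.
have : ~~ (s <= u) by rewrite -ltNge.
(* Since [s < r] takes care of the seed of [block_min], having [s <= tau i] on all of [B] would give
   [s <= u]. *)
have [/forall_inP all_le|] := boolP [forall (i | i \in B), s <= tau i].
  by rewrite le_bigmin //; exact: ltW.
rewrite negb_forall_in => /exists_inP[i iB /=]; rewrite -ltNge => tis _.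
exists i => //; rewrite /last_hop /linked tE ger0_norm; last by have := htau i; lra.
by rewrite [X in _ && X](_ : _ = false) ?andbF //; apply/negbTE; rewrite -ltNge; lra.
Qed.

End last_cell.

Section grid_avoidance.
Context (R : realType) (r : R) (lam : nat -> R -> R).
Hypothesis hlam : forall l : nat, (1 <= l)%N -> cell_density r (lam l).
Context d (Omega : measurableType d) (P : probability Omega R).
Context (k : nat) (D : set R) (eta : Omega -> {fset R}).
Hypothesis heta : poisson_process P D (intensity r lam k) eta.

Definition hits_grid : set Omega := [set w | exists2 y, y \in eta w & grid r y].

Let hits_gridE : hits_grid = ~` [set w | node_count eta (grid r) w = 0%N].
Proof.
apply/seteqP; split => w /=.
  move=> [y yw gy] /eqP; rewrite cardfs_eq0 => /eqP/fsetP/(_ y).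
  by rewrite !inE yw mem_set.
move=> h; apply: contrapT => ng; apply: h; apply/eqP; rewrite cardfs_eq0.
apply/eqP/fsetP => y; rewrite !inE; apply/negP => /andP[yw /set_mem gy].
by apply: ng; exists y.
Qed.

Let m0 : measurable [set w | node_count eta (grid r) w = 0%N].
Proof.
case: heta => _ h _ _.
by have := h _ (measurable_grid r) measurableT [set 0%N] I; rewrite setTI.
Qed.

Lemma measurable_hits_grid : measurable hits_grid.
Proof. by rewrite hits_gridE; exact: measurableC. Qed.

Lemma hits_grid_null : P hits_grid = 0%E.
Proof.
rewrite hits_gridE probability_setC //; case: heta => _ _ h _.
rewrite (h _ 0%N (measurable_grid r)) (intensity_grid hlam) /=.
by rewrite oppr0 expR0 expr0 fact0 divr1 mulr1 subee.
Qed.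

End grid_avoidance.

Section moment_recursion.
Context (R : realType) (r : R) (hr : 0 < r) (lam : nat -> R -> R).
Hypothesis hlam : forall l : nat, (1 <= l)%N -> cell_density r (lam l).
Context (k n : nat) (tau : 'I_n -> R).
Hypothesis htau : forall i, 0 <= tau i <= r.
Context d (Omega : measurableType d) (P : probability Omega R).
Context (eta1 eta2 : Omega -> {fset R}) (D1 D2 : set R).
Hypothesis heta1 : poisson_process P D1 (intensity r lam k.+1) eta1.
Hypothesis heta2 : poisson_process P D2 (intensity r lam k.+2) eta2.
Local Notation RM := (measurableTypeR R).
Local Notation mu := (@lebesgue_measure R).
Local Notation low := (`]-oo, k%:R * r]%classic : set RM).
Local Notation t i := (k.+2%:R * r - tau i).
Let N w : R := #|` eta1 w|%:R.
Let g (s : R) : R := lam k.+1 (r - s).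

Definition walks_power (m : nat) (s : R) (w : Omega) : R :=
  (walks r k (eta1 w) (k.+1%:R * r - s))%:R ^+ m.

Lemma node_moments p : (\int[P]_w ((1 + N w) ^+ p)%:E < +oo)%E.
Proof.
exact: (card_nodes_moments (intensity_density_ge0 hlam k.+1)
  (integrable_intensity_density hlam k.+1) heta1).
Qed.

Lemma measurable_nodes : measurable_fun setT N.
Proof. exact: measurable_card_nodes heta1. Qed.

Lemma bounded_walks_power m : bounded_kernel N (walks_power m).
Proof.
split.
  apply: measurable_funX; apply/measurable_EFinP.
  apply: (measurableT_comp (measurable_walks r k)
    (g := fun u : RM * Omega => (eta1 u.2 : configs R, k.+1%:R * r - u.1 : RM))).
  apply: measurable_fun_pair.
    exact: (measurableT_comp (measurable_eta heta1) measurable_snd).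
  exact: (measurableT_comp (measurable_reflect _) measurable_fst).
exists 1, (k * m)%N; split => // s w; rewrite /walks_power exprn_ge0 //=.
rewrite /bound_by mul1r exprM; apply: lerXn2r; rewrite ?nnegrE ?exprn_ge0 // /N ?addr_ge0 //.
apply: (@le_trans _ _ (#|` eta1 w|%:R ^+ k)); first by rewrite -natrX ler_nat walks_le.
by apply: lerXn2r; rewrite ?nnegrE ?addr_ge0 // lerDr.
Qed.

(** A last node linked to [t i] is at least [k%:R * r], and equality is impossible for a node of
    [eta1] off the grid; so it comes from [eta2]. The walks leading to it use only nodes up to
    [k%:R * r], which come from [eta1]. *)
Lemma walks_glue w1 w2 i : ~ hits_grid r eta1 w1 ->
  walks r k.+1 (glue low eta1 eta2 (w1, w2)) (t i) =
  fset_total (last_hop r k tau (eta1 w1)) i (eta2 w2).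
Proof.
move=> ng; rewrite /= /fset_total /last_hop -big_mkcond /=.
have memg y : (y \in glue low eta1 eta2 (w1, w2)) =
    if y <= k%:R * r then y \in eta1 w1 else y \in eta2 w2.
  rewrite /glue !inE /= !mem_setE !in_itv /=.
  by case: ifP; rewrite ?andbT ?andbF ?orbF ?orFb.
transitivity (\sum_(y <- [seq y <- eta2 w2 | ((k%:R * r < y) && linked r y (t i))%R])
    walks r k (glue low eta1 eta2 (w1, w2)) y)%N.
  rewrite -big_filter; apply: perm_big; apply: uniq_perm.
  - exact/filter_uniq/fset_uniq.
  - exact/filter_uniq/fset_uniq.
  move=> y; rewrite !mem_filter memg ltNge; case: ifPn => //= yk.
  apply/negP => /andP[]; rewrite /linked ler_norml => /andP[_ ty] yw1.
  apply: ng; exists y => //; exists k; apply/eqP; rewrite eq_le yk /=.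
  move: ty; have := htau i; rewrite -[k.+2%:R]natr1 -[k.+1%:R]natr1; lra.
rewrite big_filter; apply: eq_bigr => y _; apply: walks_filter; first exact: ltW.
by move=> z zk; rewrite memg zk.
Qed.

(** Freezing [w1] freezes the lower cells: the factors become sums over the nodes of [eta2] of the
    fixed bounded functions [last_hop], and [poisson_moments] applies. *)
Lemma moment_recursion (C : {set 'I_n}) :
  (\int[P]_w (\prod_(i in C) (walks r k.+1 (eta2 w) (t i))%:R)%:E =
   \sum_(pi | setpart pi C)
     \int[P]_w (\prod_(B in pi) last_weight r lam k tau (eta1 w) B)%:E)%E.
Proof.
have dZ (B : {set 'I_n}) : dominated N (fun w => last_weight r lam k tau (eta1 w) B).
  have ur : block_min r tau B <= r by exact: bigmin_le_id.
  exact: (@dominated_weighted_integral _ _ _ N r g (@last_density_ge0 _ r lam hlam k)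
    (integrable_last_density hlam k) _ ur _ (bounded_walks_power #|B|)).
have dprod (pi : {set {set 'I_n}}) :
    dominated N (fun w => \prod_(B in pi) last_weight r lam k tau (eta1 w) B).
  by apply: dominated_prod.
have prod0 (pi : {set {set 'I_n}}) w :
    0 <= \prod_(B in pi) last_weight r lam k tau (eta1 w) B.
  by have [_ [? [? [_ /(_ w)/andP[]]]]] := dprod pi.
pose Psi (V : configs R) : \bar R :=
  (\prod_(i in C) (walks r k.+1 (V : {fset R}) (t i))%:R)%:E.
have mPsi : measurable_fun setT Psi.
  apply/measurable_EFinP; under eq_fun do rewrite -big_filter.
  apply: measurable_prod => i _; apply/measurable_EFinP.
  exact: (@measurable_fun_pair1 _ _ _ (configs R) RM _ _ (t i) (measurable_walks r k.+1)).
have Psi0 V : (0 <= Psi V)%E by rewrite lee_fin prodr_ge0.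
have mlow : measurable low by exact: measurable_itv.
have L12 A : A `<=` low -> intensity r lam k.+1 A = intensity r lam k.+2 A.
  move=> Alow; apply: eq_integral => x /set_mem/Alow; rewrite /= in_itv /= => xk.
  rewrite [in RHS]intensity_density_low //; apply: le_trans xk _.
  by rewrite ler_wpM2r ?(ltW hr) // ler_nat.
rewrite -[LHS]/(\int[P]_w Psi (eta2 w))%E.
rewrite (integral_glue mlow heta1 heta2 L12 mPsi Psi0).
(* The inner integral is computed only when [eta1] avoids the grid at [w1]; the other [w1] form a
   null set. *)
rewrite (@ge0_integral_eq_off_null _ _ _ P _
  (fun w => \sum_(pi | setpart pi C)
     (\prod_(B in pi) last_weight r lam k tau (eta1 w) B)%:E)%E
  (hits_grid r eta1)) //.
- under eq_integral do rewrite -big_filter.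
  rewrite ge0_integral_sum //; first by rewrite big_filter.
  + by move=> pi; apply/measurable_EFinP; have [] := dprod pi.
  + by move=> pi w _; rewrite lee_fin.
- exact: measurable_hits_grid heta1.
- exact: (hits_grid_null hlam heta1).
- under eq_fun do rewrite sumEFin -big_filter; apply/measurable_EFinP.
  by apply: measurable_sum => pi; have [] := dprod pi.
- by move=> w; apply: integral_ge0.
- by move=> w; rewrite sumEFin lee_fin sumr_ge0.
move=> w1 ng; rewrite sumEFin.
transitivity (\int[P]_w2 (\prod_(i in C)
    (fset_total (last_hop r k tau (eta1 w1)) i (eta2 w2))%:R)%:E)%E.
  apply: eq_integral => w2 _; congr EFin; apply: eq_bigr => i _.
  by rewrite walks_glue.
rewrite (@poisson_moments _ _ _ P D2 (intensity_density r lam k.+2) eta2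
  (intensity_density_ge0 hlam k.+2) (integrable_intensity_density hlam k.+2) heta2
  'I_n (last_hop r k tau (eta1 w1)) (#|` eta1 w1| ^ k)).
- congr EFin; apply: eq_bigr => pi piP; apply: eq_bigr => B Bpi.
  by rewrite (weight_last_hop hr hlam _ htau) //; exact: partition_neq0 piP Bpi.
- by move=> i; exact: measurable_last_hop.
- by move=> i x; exact: last_hop_le.
Qed.

End moment_recursion.

(** * From walks back to hop counts *)

Lemma eq_iterated_integral (R : realType) (g : R -> R) (us : seq R)
    (f h : seq R -> R) :
  (forall ss, size ss = size us ->
    (forall j, (j < size us)%N -> 0 <= ss`_j <= us`_j) -> f ss = h ss) ->
  iterated_integral g us f = iterated_integral g us h.
Proof.
elim: us f h => [|u us IH] f h fh /=; first by apply: fh.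
apply: eq_Rintegral => s; rewrite inE /= in_itv /= => su; congr (_ * _).
apply: IH => ss sz ssu; apply: fh => /=; first by rewrite sz.
by move=> [_|j] //=; exact: ssu.
Qed.

Section almost_surely_equal.
Context (R : realType) d (Omega : measurableType d) (P : probability Omega R).
Context (n : nat) (N : set Omega) (X Y : 'I_n -> Omega -> R).
Hypothesis mN : measurable N.
Hypothesis N0 : P N = 0%E.
Hypothesis X0 : forall i w, 0 <= X i w.
Hypothesis Y0 : forall i w, 0 <= Y i w.
Hypothesis mY : forall i, measurable_fun setT (Y i).
Hypothesis XY : forall i w, ~ N w -> X i w = Y i w.

(** Measurability is asked of [Y] only: [X] stands for the hop counts, [Y] for the walk counts that
    replace them off the grid event. *)
Lemma mixed_moment_off_null B : mixed_moment P X B = mixed_moment P Y B.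
Proof.
rewrite /mixed_moment unlock; congr fine.
apply: (ge0_integral_eq_off_null mN N0).
- apply/measurable_EFinP; under eq_fun do rewrite -big_filter.
  by apply: measurable_prod => i _.
- by move=> w; rewrite lee_fin prodr_ge0.
- by move=> w; rewrite lee_fin prodr_ge0.
- by move=> w Nw; congr EFin; apply: eq_bigr => i _; exact: XY.
Qed.

Lemma joint_cumulant_off_null : joint_cumulant P X = joint_cumulant P Y.
Proof.
rewrite /joint_cumulant; apply: eq_bigr => l _; congr (_ * _).
apply: eq_bigr => pi _; apply: eq_bigr => B _; exact: mixed_moment_off_null.
Qed.
End almost_surely_equal.

Lemma measurable_walks_at (R : realType) (r x : R) j d (Omega : measurableType d)
    (P : probability Omega R) (D : set R) (Lambda : set R -> \bar R)
    (eta : Omega -> {fset R}) : poisson_process P D Lambda eta ->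
  measurable_fun setT (fun w => (walks r j (eta w) x)%:R : R).
Proof.
move=> heta; apply/measurable_EFinP.
have mw := @measurable_fun_pair1 _ _ _ (configs R) (measurableTypeR R) _ _ x
  (measurable_walks r j).
exact: (measurableT_comp mw (measurable_eta heta)).
Qed.

Lemma hop_count_off_grid (R : realType) (r : R) d (Omega : measurableType d)
    (eta : Omega -> {fset R}) j x w :
  0 <= r -> ~ hits_grid r eta w -> j%:R * r <= x ->
  hop_count r (eta w) j.+1 x = walks r j (eta w) x.
Proof.
move=> r0 ng jx; apply: hop_count_walks => // y yw i; apply/eqP => yi.
by apply: ng; exists y => //; exists i.
Qed.

Unset Implicit Arguments.

(* The node located at k r - s has coordinate r - s in the k-th cell, whence
   the density lam k (r - s) in the integration variable s. *)
Theorem proposition6p1 (R : realType) (r : R) (hr : 0 < r)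
  (lam : nat -> R -> R)
  (hlam : forall l : nat, (1 <= l)%N -> cell_density r (lam l))
  (d : measure_display) (Omega : measurableType d) (P : probability Omega R)
  (eta : nat -> Omega -> {fset R})
  (heta : forall k : nat, (1 <= k)%N ->
     poisson_process P `[0, k%:R * r] (intensity r lam k) (eta k))
  (k n : nat) (hk : (1 <= k)%N) (hn : (1 <= n)%N)
  (tau : 'I_n -> R) (htau : forall i : 'I_n, 0 <= tau i <= r) :
  joint_cumulant P (fun (i : 'I_n) (w : Omega) =>
    (hop_count r (eta k.+1 w) k.+1 (k.+1%:R * r - tau i))%:R) =
  \sum_(1 <= l < n.+1)
    \sum_(pi : {set {set 'I_n}} |
            finset.partition pi [set: 'I_n]%SET && (#|pi| == l))
      iterated_integral (fun s : R => lam k (r - s))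
        [seq block_min r tau B | B <- enum pi]
        (fun s : seq R =>
           joint_cumulant P (fun (j : 'I_#|pi|) (w : Omega) =>
             (hop_count r (eta k w) k (k%:R * r - s`_j))%:R
               ^+ #|enum_val j|)).
Proof.
(* From here on [k] is the predecessor of the original index. *)
case: k hk => // k _.
have heta1 := heta k.+1 isT; have heta2 := heta k.+2 isT.
have r0 := ltW hr.
pose N w : R := #|` eta k.+1 w|%:R.
have N_ge0 w : 0 <= N w by [].
have Nmom := node_moments hlam heta1; have mN := measurable_nodes heta1.
pose g (s : R) := lam k.+1 (r - s).
have g_ge0 := @last_density_ge0 _ r lam hlam k : forall s, 0 <= s <= r -> 0 <= g s.
have ig := integrable_last_density hlam k.
pose Z (B : {set 'I_n}) w := last_weight r lam k tau (eta k.+1 w) B.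
have yB m := @bounded_walks_power _ r lam k _ _ P _ _ heta1 m.
have bmin (B : {set 'I_n}) : block_min r tau B <= r by exact: bigmin_le_id.
have dZ B : dominated N (Z B).
  exact: (@dominated_weighted_integral _ _ _ N r g g_ge0 ig _ (bmin B) _ (yB #|B|)).
rewrite (@joint_cumulant_off_null _ _ _ P _ (hits_grid r (eta k.+2)) _
  (fun i w => (walks r k.+1 (eta k.+2 w) (k.+2%:R * r - tau i))%:R)) //; last first.
- move=> i w ng; rewrite hop_count_off_grid //.
  by have := htau i; rewrite -[k.+2%:R]natr1 mulrDl mul1r; lra.
- by move=> i; exact: measurable_walks_at heta2.
- exact: (hits_grid_null hlam heta2).
- exact: measurable_hits_grid heta2.
rewrite (@joint_cumulant_block_sum _ _ _ P n _ Z hn); last first.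
  move=> C; rewrite /mixed_moment unlock (moment_recursion hr hlam htau heta1 heta2).
  rewrite -sum_fine // => pi _; apply: (dominated_fin N_ge0 Nmom mN).
  by apply: dominated_prod => B _; exact: dZ.
apply: eq_bigr => l _; apply: eq_bigr => pi /andP[piP /eqP pil].
pose us := [seq block_min r tau B | B <- enum pi].
(* The peeling lemma wants a family over all of [nat]; the default block [set0] is reached only for
   [j] beyond the blocks of [pi], which no argument uses. *)
pose y (j : nat) := walks_power r k (eta k.+1) #|nth finset.set0 (enum pi) j|.
have yE (j : 'I_#|pi|) : nth finset.set0 (enum pi) j = enum_val j.
  by rewrite (enum_val_nth finset.set0).
have szus : size us = #|pi| by rewrite size_map -cardE.
(* On the domain of integration the variables are bounded by block minima, hence by [r]; the
   endpoints are then at least [k%:R * r], where hop and walk counts agree off the grid event. *)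
rewrite [RHS](@eq_iterated_integral _ _ _ _ (fun ss => joint_cumulant P
  (fun (j : 'I_#|pi|) w => y j ss`_j w))); last first.
  move=> ss _ ssu.
  apply: (@joint_cumulant_off_null _ _ _ P _ (hits_grid r (eta k.+1))) => //.
  - exact: measurable_hits_grid heta1.
  - exact: (hits_grid_null hlam heta1).
  - by move=> j w; rewrite exprn_ge0.
  - by move=> j; apply: measurable_funX; exact: measurable_walks_at heta1.
  - move=> j w ng; rewrite /y /walks_power yE hop_count_off_grid //.
    have js : (j < size us)%N by rewrite szus.
    have /andP[_ sj] := ssu j js.
    rewrite (nth_map finset.set0) -?cardE // in sj.
    have := le_trans sj (bmin _); rewrite -[k.+1%:R]natr1 mulrDl mul1r; lra.
have usr u : u \in us -> u <= r by move=> /mapP[B _ ->].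
(* With [a = 0] no argument is frozen yet; the zero family is a placeholder. *)
have := @iterated_joint_cumulant _ _ _ P N N_ge0 Nmom mN r g g_ge0 ig #|pi| y us
  (fun j => yB _) usr 0%N (fun _ _ => 0) szus (fun _ => dominated_cst _ (lexx 0)).
move=> E; transitivity (joint_cumulant P (fun j : 'I_#|pi| =>
    weighted_integral g (y j) us`_j)).
  congr joint_cumulant; apply/funext => j; apply/funext => w.
  by rewrite (nth_map finset.set0) -?cardE // /y yE.
transitivity (joint_cumulant P (fun j : 'I_#|pi| => if (j < 0)%N then (fun=> 0)
    else weighted_integral g (y j) us`_(j - 0))).
  by congr joint_cumulant; apply/funext => j; rewrite subn0.
rewrite -E; congr iterated_integral; apply/funext => ss; congr joint_cumulant.
by apply/funext => j; rewrite subn0.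
Qed.
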